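(* Let $Q$ be a finite quiver, let $\beta\in\mathbb{Z}_{\ge0}^{Q_0}$ be a dimension vector, and let $V$ be a finite-dimensional representation of $Q$ over a field $\mathbb{F}$. Then $$\operatorname{ncext}(V,\beta)=\max\{-\langle\underline{\dim}\,V',\beta\rangle\mid V'\text{ a subrepresentation of }V\}.$$
   Context: $\operatorname{Rep}_\beta(Q)$ is the space of representations of $Q$ with dimension vector $\beta$. The Euler form is $\langle\alpha,\beta\rangle=\sum_{x\in Q_0}\alpha(x)\beta(x)-\sum_{a\in Q_1}\alpha(ta)\beta(ha)$, where $ta,ha$ are the tail and head of the arrow $a$; $\dim\operatorname{Hom}_Q(V,W)-\dim\operatorname{Ext}_Q(V,W)=\langle\underline{\dim}\,V,\underline{\dim}\,W\rangle$, where $\operatorname{Ext}_Q=\operatorname{Ext}^1_Q$. General hom and ext: let $t$ be the minimal value of $\dim\operatorname{Hom}_Q(V,W)$ over $W\in\operatorname{Rep}_\beta(Q)$. For any $W\in\operatorname{Rep}_\beta(Q)$ attaining this minimum, $\hom(V,\beta)=\dim\operatorname{Hom}_Q(V,W)$ and $\operatorname{ext}(V,\beta)=\dim\operatorname{Ext}_Q(V,W)$. Non-commutative ext: $\operatorname{ncext}(V,\beta)=\lim_{d\to\infty}\operatorname{ext}(V,d\beta)/d$. *)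

(* Defs.v *)
From HB Require Import structures.
From mathcomp Require Import all_boot all_order all_algebra.
From mathcomp Require Import all_classical all_reals all_analysis.

Set Implicit Arguments.
Unset Strict Implicit.
Unset Printing Implicit Defensive.

Import Order.TTheory GRing.Theory Num.Theory.
Import numFieldNormedType.Exports.
Import VectorInternalTheory.

Local Open Scope ring_scope.

(* MathComp only makes non-dependent finite products of vector spaces into    *)
(* vector spaces; the families of linear maps indexed by vertices or arrows   *)
(* live in dependent ones.                                                    *)
Section DependentProduct.
Variables (F : fieldType) (I : finType) (V : I -> vectType F).

Definition dprodv := {dffun forall i, V i}.

HB.instance Definition _ := Choice.on dprodv.

Implicit Types f g h : dprodv.

Definition dpv0 : dprodv := [ffun i => 0 : V i].
Definition dpvN f : dprodv := [ffun i => - f i].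
Definition dpvD f g : dprodv := [ffun i => f i + g i].
Definition dpvZ (c : F) f : dprodv := [ffun i => c *: f i].

Fact dpvDA : associative dpvD.
Proof. by move=> f g h; apply/ffunP => i; rewrite !ffunE addrA. Qed.
Fact dpvDC : commutative dpvD.
Proof. by move=> f g; apply/ffunP => i; rewrite !ffunE addrC. Qed.
Fact dpv0D : left_id dpv0 dpvD.
Proof. by move=> f; apply/ffunP => i; rewrite !ffunE add0r. Qed.
Fact dpvND : left_inverse dpv0 dpvN dpvD.
Proof. by move=> f; apply/ffunP => i; rewrite !ffunE addNr. Qed.

HB.instance Definition _ := GRing.isZmodule.Build dprodv dpvDA dpvDC dpv0D dpvND.

Fact dpvZA a b f : dpvZ a (dpvZ b f) = dpvZ (a * b) f.
Proof. by apply/ffunP => i; rewrite !ffunE scalerA. Qed.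
Fact dpv1Z : left_id 1 dpvZ.
Proof. by move=> f; apply/ffunP => i; rewrite !ffunE scale1r. Qed.
Fact dpvZDr : right_distributive dpvZ +%R.
Proof. by move=> a f g; apply/ffunP => i; rewrite !ffunE scalerDr. Qed.
Fact dpvZDl f : {morph dpvZ^~ f : a b / a + b}.
Proof. by move=> a b; apply/ffunP => i; rewrite !ffunE scalerDl. Qed.

HB.instance Definition _ :=
  GRing.Zmodule_isLmodule.Build F dprodv dpvZA dpv1Z dpvZDr dpvZDl.

Lemma dpvDE f g i : (f + g) i = f i + g i. Proof. exact: ffunE. Qed.
Lemma dpvNE f i : (- f) i = - f i. Proof. exact: ffunE. Qed.
Lemma dpvZE c f i : (c *: f) i = c *: f i. Proof. exact: ffunE. Qed.
Lemma dpv0E i : (0 : dprodv) i = 0. Proof. exact: ffunE. Qed.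

Fact dprodv_vect_iso : Vector.axiom (\sum_(k < #|I|) dim (V (enum_val k))) dprodv.
Proof.
exists (fun f => \mxrow_(k < #|I|) v2r (f (enum_val k))).
  move=> a f g; apply/mxrowP => k.
  have subZ (A : 'rV[F]_(\sum_(l < #|I|) dim (V (enum_val l)))) :
       submxrow (a *: A) k = a *: submxrow A k.
    by apply/matrixP => i j; rewrite !mxE.
  by rewrite submxrowD subZ !mxrowK dpvDE dpvZE linearP.
pose cast i j (e : i = j) (v : V i) : V j := ecast k (V k) e v.
pose s (r : 'rV[F]_(\sum_(k < #|I|) dim (V (enum_val k)))) k :=
  r2v (submxrow r k) : V (enum_val k).
exists (fun r => [ffun i => cast _ _ (enum_rankK i) (s r (enum_rank i))] : dprodv).
  move=> f; apply/ffunP => i; rewrite ffunE /s mxrowK v2rK.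
  have castf l m (e : l = m) : cast _ _ e (f l) = f m by case: _ / e.
  exact: castf.
move=> r; apply/mxrowP => k; rewrite mxrowK ffunE.
have castK l (e : enum_val l = enum_val k) : cast _ _ e (s r l) = s r k.
  have lk := enum_val_inj e; case: _ / lk in e *.
  by rewrite (eq_irrelevance e erefl).
by rewrite castK r2vK.
Qed.

HB.instance Definition _ := Lmodule_hasFinDim.Build F dprodv dprodv_vect_iso.

End DependentProduct.

Section LinearMap.
Variables (F : fieldType) (U V : vectType F) (f : U -> V) (fL : linear f).

Definition linmap : 'Hom(U, V) :=
  let g := HB.pack_for {linear U -> V} f (GRing.isLinear.Build F U V *:%R f fL) in
  linfun g.

Lemma linmapE : linmap =1 f. Proof. exact: lfunE. Qed.

End LinearMap.

Record quiver := Quiver {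
  vertex : finType;
  arrow : finType;
  tl : arrow -> vertex;
  hd : arrow -> vertex }.

Definition dimvec (Q : quiver) := vertex Q -> nat.

Definition euler (Q : quiver) (alpha beta : dimvec Q) : int :=
  \sum_(x : vertex Q) (alpha x)%:Z * (beta x)%:Z
  - \sum_(a : arrow Q) (alpha (tl a))%:Z * (beta (hd a))%:Z.

Record rep (F : fieldType) (Q : quiver) := Rep {
  rspace :> vertex Q -> vectType F;
  rmap : forall a : arrow Q, 'Hom(rspace (tl a), rspace (hd a)) }.

Section Representations.
Variables (F : fieldType) (Q : quiver).
Implicit Types (V W : rep F Q) (beta : dimvec Q).

Definition subrep V (U : forall x, {vspace V x}) : Prop :=
  forall a, (rmap V a @: U (tl a) <= U (hd a))%VS.

Definition subdim V (U : forall x, {vspace V x}) : dimvec Q := fun x => \dim (U x).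

Definition Rep_of beta : Type :=
  forall a : arrow Q, 'Hom('rV[F]_(beta (tl a)), 'rV[F]_(beta (hd a))).

Definition to_rep beta (W : Rep_of beta) : rep F Q :=
  @Rep F Q (fun x => 'rV[F]_(beta x) : vectType F) W.
Coercion to_rep : Rep_of >-> rep.

Definition morph V W (phi : forall x, 'Hom(V x, W x)) : Prop :=
  forall a v, phi (hd a) (rmap V a v) = rmap W a (phi (tl a) v).

Definition vertex_maps V W := dprodv (fun x => 'Hom(V x, W x) : vectType F).
Definition arrow_maps V W :=
  dprodv (fun a : arrow Q => 'Hom(V (tl a), W (hd a)) : vectType F).

Definition commutator V W (phi : vertex_maps V W) : arrow_maps V W :=
  [ffun a => ((phi (hd a) \o rmap V a) - (rmap W a \o phi (tl a)))%VF].

Fact commutator_is_linear V W : linear (@commutator V W).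
Proof.
move=> c f g; apply/ffunP => a; rewrite dpvDE dpvZE !ffunE; apply/lfunP => v.
rewrite !(add_lfunE, opp_lfunE, scale_lfunE, comp_lfunE).
by rewrite linearP scalerBr opprD addrACA.
Qed.

HB.instance Definition _ V W :=
  GRing.isLinear.Build F (vertex_maps V W) (arrow_maps V W) *:%R
    (@commutator V W) (@commutator_is_linear V W).

Definition Hom_Q V W : {vspace vertex_maps V W} := lker (linfun (@commutator V W)).

Lemma mem_Hom_Q V W (phi : vertex_maps V W) : phi \in Hom_Q V W <-> morph phi.
Proof.
rewrite memv_ker lfunE /=; split=> [/eqP phi0 a v|phiM].
  have /lfunP/(_ v) := congr1 (fun f : arrow_maps V W => f a) phi0.
  rewrite dpv0E ffunE !(add_lfunE, opp_lfunE, comp_lfunE) zero_lfunE.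
  exact: subr0_eq.
apply/eqP/ffunP => a; rewrite dpv0E ffunE; apply/lfunP => v.
by rewrite !(add_lfunE, opp_lfunE, comp_lfunE) phiM subrr zero_lfunE.
Qed.

(* Ext^1_Q(V, W) is the Yoneda group of the exact sequences                   *)
(* 0 -> W -> E -> V -> 0, up to equivalence.                                  *)
Record extension V W := Extension {
  mid :> rep F Q;
  inj : forall x, 'Hom(W x, mid x);
  prj : forall x, 'Hom(mid x, V x);
  inj_morph : morph inj;
  prj_morph : morph prj;
  inj_ker0 : forall x, lker (inj x) = 0%VS;
  inj_prj : forall x, limg (inj x) = lker (prj x);
  prj_img : forall x, limg (prj x) = fullv }.

Definition ext_equiv V W (E E' : extension V W) : Prop :=
  exists f : forall x, 'Hom(E x, E' x),
    [/\ morph f, forall x w, f x (inj E x w) = inj E' x w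
      & forall x e, prj E' x (f x e) = prj E x e].

(* [E3] = c [E1] + [E2] for the Baer sum: E3 is the pushout of the extension  *)
(* 0 -> W (+) W -> E1 x_V E2 -> V -> 0 along (w1, w2) |-> c w1 + w2. The maps *)
(* f x matter only on the fibre product E1 x x_(V x) E2 x.                    *)
Definition ext_lincomb V W (c : F) (E1 E2 E3 : extension V W) : Prop :=
  exists f : forall x, 'Hom((E1 x * E2 x)%type, E3 x),
    [/\ forall a e1 e2, prj E1 _ e1 = prj E2 _ e2 ->
          f (hd a) (rmap E1 a e1, rmap E2 a e2) = rmap E3 a (f (tl a) (e1, e2)),
        forall x w1 w2,
          f x (inj E1 x w1, inj E2 x w2) = inj E3 x (c *: w1 + w2)
      & forall x e1 e2, prj E1 x e1 = prj E2 x e2 ->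
          prj E3 x (f x (e1, e2)) = prj E1 x e1].

(* Ext^1_Q(V, W) has dimension n: there is a linear bijection from F^n onto   *)
(* the set of equivalence classes of extensions.                              *)
Definition Ext_has_dim V W (n : nat) : Prop :=
  exists E : 'rV[F]_n -> extension V W,
    [/\ forall u v, ext_equiv (E u) (E v) -> u = v,
        forall X, exists u, ext_equiv (E u) X
      & forall c u v, ext_lincomb c (E u) (E v) (E (c *: u + v))].

Section Cocycles.
Variables V W : rep F Q.
Implicit Types xi eta zeta : arrow_maps V W.

Definition coc_fun xi a (u : (W (tl a) * V (tl a))%type) :
    (W (hd a) * V (hd a))%type :=
  (rmap W a u.1 + xi a u.2, rmap V a u.2).
Arguments coc_fun : clear implicits.

Fact coc_fun_is_linear xi a : linear (coc_fun xi a).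
Proof.
move=> c [w v] [w' v']; congr (_, _); last exact: linearP.
by rewrite /= !linearP /= scalerDr addrACA.
Qed.
Definition coc_rep xi : rep F Q :=
  @Rep F Q (fun x => (W x * V x)%type : vectType F)
    (fun a => linmap (@coc_fun_is_linear xi a)).

Lemma coc_repE xi a u : rmap (coc_rep xi) a u = coc_fun xi a u.
Proof. exact: linmapE. Qed.

Fact coc_inj_is_linear x : linear (fun w => (w, 0) : (W x * V x)%type).
Proof. by move=> c w w'; congr (_, _); rewrite /= scaler0 addr0. Qed.
Fact coc_prj_is_linear x : linear (fun u : (W x * V x)%type => u.2).
Proof. by []. Qed.

Definition coc_inj x := linmap (@coc_inj_is_linear x).
Definition coc_prj x := linmap (@coc_prj_is_linear x).

Fact coc_inj_morph xi : @morph W (coc_rep xi) coc_inj.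
Proof.
move=> a w; rewrite coc_repE !linmapE /coc_fun /=.
by congr (_, _); rewrite ?linear0 ?addr0.
Qed.

Fact coc_prj_morph xi : @morph (coc_rep xi) V coc_prj.
Proof. by move=> a u; rewrite coc_repE !linmapE. Qed.

Fact coc_inj_ker0 x : lker (coc_inj x) = 0%VS.
Proof. by apply/eqP/lker0P => w w'; rewrite !linmapE => -[]. Qed.

Fact coc_inj_prj x : limg (coc_inj x) = lker (coc_prj x).
Proof.
apply/vspaceP => u; rewrite memv_ker linmapE.
apply/memv_imgP/eqP => [[w _ ->]|u0]; first by rewrite linmapE.
by exists u.1; rewrite ?memvf // linmapE -u0 -surjective_pairing.
Qed.

Fact coc_prj_img x : limg (coc_prj x) = fullv.
Proof.
apply/vspaceP => v; rewrite memvf; apply/memv_imgP.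
by exists (0, v); rewrite ?memvf // linmapE.
Qed.

Definition coc_ext xi : extension V W := Extension (@coc_inj_morph xi)
  (@coc_prj_morph xi) coc_inj_ker0 coc_inj_prj coc_prj_img.

Let cobound : {vspace arrow_maps V W} := limg (linfun (@commutator V W)).

Lemma coboundP xi : reflect
  (exists phi : vertex_maps V W,
     forall a v, xi a v = phi (hd a) (rmap V a v) - rmap W a (phi (tl a) v))
  (xi \in cobound).
Proof.
apply: (iffP memv_imgP) => [[phi _ ->]|[phi phiP]].
  exists phi => a v.
  by rewrite lfunE /= ffunE !(add_lfunE, opp_lfunE, comp_lfunE).
exists phi; rewrite ?memvf // lfunE; apply/ffunP => a; apply/lfunP => v.
by rewrite phiP ffunE !(add_lfunE, opp_lfunE, comp_lfunE).
Qed.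

Lemma coc_equivP xi eta :
  ext_equiv (coc_ext xi) (coc_ext eta) <-> xi - eta \in cobound.
Proof.
split=> [[f [fM fi fp]]|/coboundP[phi phiP]]; last first.
  have gL x : linear (fun u => (u.1 - phi x u.2, u.2) : (W x * V x)%type).
    move=> c u u'; congr (_, _).
    by rewrite /= linearP /= scalerBr opprD addrACA.
  exists (fun x => linmap (gL x)); split=> [a u|x w|x u] /=.
  - rewrite !coc_repE !linmapE /coc_fun /=; congr (_, _).
    have /eqP := phiP a u.2; rewrite dpvDE dpvNE add_lfunE opp_lfunE.
    rewrite subr_eq => /eqP ->; rewrite linearB /= -!addrA; congr (_ + _).
    by rewrite !addrA addrAC [_ - phi _ _]addrAC subrr add0r.
  - by rewrite !linmapE linear0 subr0.
  - by rewrite !linmapE.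
have f0E x v : f x (0, v) = ((f x (0, v)).1, v).
  by have := fp x (0, v); rewrite /= !linmapE /=; case: (f x _) => p1 p2 /= ->.
have hL x : linear (fun v => - (f x (0, v)).1).
  move=> c v v'; rewrite scalerN -opprD; congr (- _).
  have -> : (0, c *: v + v') = c *: (0, v) + (0, v') :> (W x * V x)%type.
    by congr (_, _); rewrite /= scaler0 addr0.
  by rewrite linearP.
apply/coboundP; exists ([ffun x => linmap (hL x)] : vertex_maps V W) => a v.
have := fM a (0, v); rewrite !coc_repE f0E /coc_fun /= linear0 add0r.
have -> : (xi a v, rmap V a v) =
    coc_inj _ (xi a v) + (0, rmap V a v) :> (W (hd a) * V (hd a))%type.
  by rewrite linmapE; congr (_, _); rewrite /= ?addr0 ?add0r.
rewrite linearD /= (fi _ (xi a v)) linmapE f0E => -[+].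
rewrite dpvDE dpvNE add_lfunE opp_lfunE !ffunE !linmapE linearN /= opprK.
by move=> /(canRL (addrK _)) ->; rewrite addrAC addrK addrC.
Qed.

Lemma coc_lincomb c xi eta :
  ext_lincomb c (coc_ext xi) (coc_ext eta) (coc_ext (c *: xi + eta)).
Proof.
have gL x : linear (fun u : ((W x * V x) * (W x * V x))%type =>
    (c *: u.1.1 + u.2.1, u.1.2) : (W x * V x)%type).
  move=> b u v; congr (_, _).
  by rewrite /= !scalerDr !scalerA [b * c]mulrC addrACA.
exists (fun x => linmap (gL x)); split=> [a|x w1 w2|x] /=.
- move=> [w1 v1] [w2 v2]; rewrite !linmapE /= => <-.
  congr (_, _); rewrite linearP /= dpvDE dpvZE add_lfunE scale_lfunE.
  by rewrite scalerDr addrACA.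
- by rewrite !linmapE.
- by move=> e1 e2; rewrite !linmapE.
Qed.

Lemma coc_lincomb_cobound c xi eta zeta :
  ext_lincomb c (coc_ext xi) (coc_ext eta) (coc_ext zeta) ->
  zeta - (c *: xi + eta) \in cobound.
Proof.
move=> [f [fM fi fp]].
have f0E x v : f x ((0, v), (0, v)) = ((f x ((0, v), (0, v))).1, v).
  have := fp x (0, v) (0, v); rewrite /= !linmapE /= => /(_ erefl).
  by case: (f x _) => p1 p2 /= ->.
have hL x : linear (fun v => (f x ((0, v), (0, v))).1).
  move=> b v v'.
  have -> : ((0, b *: v + v'), (0, b *: v + v')) =
    b *: ((0, v), (0, v)) + ((0, v'), (0, v'))
      :> ((W x * V x) * (W x * V x))%type.
    by congr ((_, _), (_, _)); rewrite /= scaler0 addr0.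
  by rewrite linearP.
apply/coboundP; exists ([ffun x => linmap (hL x)] : vertex_maps V W) => a v.
have := fM a (0, v) (0, v); rewrite /= !linmapE => /(_ erefl).
rewrite f0E /coc_fun /= linear0 !add0r.
have -> : ((xi a v, rmap V a v), (eta a v, rmap V a v)) =
    (coc_inj _ (xi a v), coc_inj _ (eta a v)) +
    ((0, rmap V a v), (0, rmap V a v))
      :> ((W (hd a) * V (hd a)) * (W (hd a) * V (hd a)))%type.
  by rewrite !linmapE; congr ((_, _), (_, _)); rewrite /= ?addr0 ?add0r.
rewrite linearD /= (fi _ (xi a v) (eta a v)) !linmapE f0E => -[+].
rewrite !(dpvDE, dpvNE, dpvZE, add_lfunE, opp_lfunE, scale_lfunE) !ffunE !linmapE.
by move=> /(canRL (addKr _)) -> _; rewrite [rmap W a _ + _]addrC addrA addrK addrC.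
Qed.

Lemma ext_cocycle (E : extension V W) :
  exists xi, ext_equiv (coc_ext xi) E /\ ext_equiv E (coc_ext xi).
Proof.
pose s x := ((prj E x)^-1)%VF; pose r x := ((inj E x)^-1)%VF.
have sK x v : prj E x (s x v) = v.
  by rewrite /s limg_lfunVK // prj_img memvf.
have injI x : injective (inj E x) by apply/lker0P/eqP/inj_ker0.
have rK x e : prj E x e = 0 -> inj E x (r x e) = e.
  by move=> e0; rewrite /r limg_lfunVK // inj_prj memv_ker e0.
have prj_inj x w : prj E x (inj E x w) = 0.
  by apply/eqP; rewrite -memv_ker -inj_prj memv_img ?memvf.
pose xi : arrow_maps V W :=
  [ffun a => (r (hd a) \o ((rmap E a \o s (tl a)) - (s (hd a) \o rmap V a)))%VF].
have xiE a v : inj E _ (xi a v) = rmap E a (s _ v) - s _ (rmap V a v).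
  rewrite ffunE comp_lfunE add_lfunE opp_lfunE !comp_lfunE rK //.
  by rewrite linearB /= prj_morph !sK subrr.
exists xi; split.
  have gL x : linear (fun u : (W x * V x)%type => inj E x u.1 + s x u.2).
    by move=> c u u'; rewrite /= !linearP /= scalerDr addrACA.
  exists (fun x => linmap (gL x)); split=> [a u|x w|x u] /=.
  - rewrite coc_repE !linmapE /= !linearD /= xiE inj_morph -!addrA.
    by rewrite addNr addr0.
  - by rewrite !linmapE /= linear0 addr0.
  - by rewrite !linmapE linearD /= prj_inj sK add0r.
have gL x : linear (fun e => (r x (e - s x (prj E x e)), prj E x e)
    : (W x * V x)%type).
  move=> c e e'; congr (_, _); last exact: linearP.
  rewrite /= -[RHS]linearP scalerBr; congr (r x _).
  by rewrite (linearP (prj E x)) (linearP (s x)) opprD addrACA.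
have qE x e : inj E x (r x (e - s x (prj E x e))) = e - s x (prj E x e).
  by rewrite rK // linearB /= sK subrr.
exists (fun x => linmap (gL x)); split=> [a e|x w|x e] /=.
- rewrite coc_repE !linmapE /coc_fun /=; congr (_, _); last exact: prj_morph.
  apply: injI; rewrite qE linearD /= inj_morph qE xiE linearB /= addrA subrK.
  by rewrite prj_morph.
- rewrite !linmapE; congr (_, _); last exact: prj_inj.
  by apply: injI; rewrite qE prj_inj linear0 subr0.
- by rewrite !linmapE.
Qed.

Lemma ext_equiv_trans (E1 E2 E3 : extension V W) :
  ext_equiv E1 E2 -> ext_equiv E2 E3 -> ext_equiv E1 E3.
Proof.
move=> [f [fM fi fp]] [g [gM gi gp]].
exists (fun x => (g x \o f x)%VF); split=> [a e|x w|x e].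
- by rewrite !comp_lfunE fM gM.
- by rewrite comp_lfunE fi gi.
- by rewrite comp_lfunE gp fp.
Qed.

Lemma ext_lincomb_equiv c (E1 E2 E3 E1' E2' E3' : extension V W) :
  ext_equiv E1' E1 -> ext_equiv E2' E2 -> ext_equiv E3 E3' ->
  ext_lincomb c E1 E2 E3 -> ext_lincomb c E1' E2' E3'.
Proof.
move=> [f1 [f1M f1i f1p]] [f2 [f2M f2i f2p]] [f3 [f3M f3i f3p]] [g [gM gi gp]].
have hL x : linear (fun e : (E1' x * E2' x)%type =>
    f3 x (g x (f1 x e.1, f2 x e.2))).
  move=> b e e'; rewrite -!linearP /=; congr (f3 x (g x (_, _))); exact: linearP.
exists (fun x => linmap (hL x)); split=> [a e1 e2|x w1 w2|x e1 e2].
- rewrite -f1p -f2p => pe; by rewrite !linmapE /= f1M f2M gM // f3M.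
- by rewrite /= linmapE /= f1i f2i gi f3i.
- by rewrite -f1p -f2p => pe; rewrite /= linmapE /= f3p gp.
Qed.

Lemma Ext_has_dimP n : Ext_has_dim V W n <-> n = \dim (cobound^C)%VS.
Proof.
have cob0 xi : xi \in cobound -> xi \in (cobound^C)%VS -> xi = 0.
  by move=> x1 x2; apply/eqP; rewrite -memv0 -(capv_compl cobound) memv_cap x1.
have red xi : exists2 eta, eta \in (cobound^C)%VS & xi - eta \in cobound.
  have : xi \in (cobound + cobound^C)%VS by rewrite addv_complf memvf.
  case/memv_addP => u uB [v vC ->]; exists v => //; by rewrite addrK.
split=> [[E [Einj Esurj Elin]]|->].
  have G_ex u : exists eta, [/\ eta \in (cobound^C)%VS,
      ext_equiv (coc_ext eta) (E u) & ext_equiv (E u) (coc_ext eta)].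
    have [xi [x1 x2]] := ext_cocycle (E u); have [eta etaC xe] := red xi.
    exists eta; split=> //.
      by apply: ext_equiv_trans x1; apply/coc_equivP; rewrite -opprB rpredN.
    by apply: ext_equiv_trans x2 _; apply/coc_equivP.
  pose G u := projT1 (cid (G_ex u)).
  have GP u : [/\ G u \in (cobound^C)%VS,
      ext_equiv (coc_ext (G u)) (E u) & ext_equiv (E u) (coc_ext (G u))].
    exact: projT2 (cid (G_ex u)).
  have GL : linear G.
    move=> c u v; have [w1 w2 w3] := GP (c *: u + v).
    have [u1 u2 u3] := GP u; have [v1 v2 v3] := GP v.
    apply/subr0_eq/cob0; last by rewrite rpredB ?rpredD ?rpredZ.
    apply: coc_lincomb_cobound.
    exact: (ext_lincomb_equiv u2 v2 w3 (Elin c u v)).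
  have Ginj : lker (linmap GL) == 0%VS.
    apply/lker0P => u v; rewrite !linmapE => Guv; apply: Einj.
    have [_ _ u3] := GP u; have [_ v2 _] := GP v.
    by apply: ext_equiv_trans u3 _; rewrite Guv.
  have <- : limg (linmap GL) = (cobound^C)%VS.
    apply/vspaceP => eta; apply/memv_imgP/idP => [[u _ ->]|etaC].
      by rewrite linmapE; have [] := GP u.
    have [u Eu] := Esurj (coc_ext eta); exists u; rewrite ?memvf // linmapE.
    have [u1 u2 _] := GP u; apply/esym/subr0_eq/cob0; last exact: rpredB.
    by apply/coc_equivP; apply: ext_equiv_trans u2 Eu.
  rewrite limg_dim_eq ?(eqP Ginj) ?capv0 // dimvf.
  by rewrite /dim /= mul1n.
pose C := (cobound^C)%VS; pose b := vbasis C.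
pose X (u : 'rV[F]_(\dim C)) := \sum_i u 0 i *: b`_i.
have bB : basis_of C b := vbasisP C.
have XC u : X u \in C.
  by apply: rpred_sum => i _; rewrite rpredZ // vbasis_mem // mem_nth ?size_tuple.
have XL : linear X.
  move=> c u v; rewrite /X scaler_sumr -big_split; apply: eq_bigr => i _ /=.
  by rewrite !mxE scalerDl scalerA.
exists (fun u => coc_ext (X u)); split=> [u v|E|c u v].
- move=> /coc_equivP /cob0; rewrite rpredB // => /(_ isT) /subr0_eq Xuv.
  apply/rowP => i; have := congr1 (coord b i) Xuv.
  by rewrite /X !coord_sum_free ?(basis_free bB).
- have [xi [x1 _]] := ext_cocycle E; have [eta etaC xe] := red xi.
  exists (\row_i coord b i eta); apply: ext_equiv_trans x1; apply/coc_equivP.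
  rewrite -opprB rpredN; suff -> : X (\row_i coord b i eta) = eta by [].
  rewrite [RHS](coord_basis bB) //; apply: eq_bigr => i _.
  by rewrite mxE.
- by rewrite XL; apply: coc_lincomb.
Qed.

End Cocycles.

Lemma Ext_has_dim_ex V W : exists n, Ext_has_dim V W n.
Proof. by eexists; apply/Ext_has_dimP. Qed.

Definition dim_Ext V W : nat := projT1 (cid (Ext_has_dim_ex V W)).

Lemma dim_ExtE V W n : Ext_has_dim V W n <-> n = dim_Ext V W.
Proof.
have dP : Ext_has_dim V W (dim_Ext V W) := projT2 (cid (Ext_has_dim_ex V W)).
by split=> [nP|->//]; move/Ext_has_dimP: nP => ->; move/Ext_has_dimP: dP => ->.
Qed.

Lemma dim_Hom_Ext V W :
  (\dim (Hom_Q V W) + \dim {:arrow_maps V W} =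
   \dim {:vertex_maps V W} + dim_Ext V W)%N.
Proof.
have -> : dim_Ext V W = \dim ((limg (linfun (@commutator V W)))^C)%VS.
  by apply/esym/dim_ExtE/Ext_has_dimP.
rewrite dimv_compl -(limg_ker_dim (linfun (@commutator V W)) fullv) capfv.
by rewrite -addnA subnKC // dimvS // subvf.
Qed.

Definition min_hom V beta (W : Rep_of beta) : Prop :=
  forall W' : Rep_of beta, (\dim (Hom_Q V W) <= \dim (Hom_Q V W'))%N.

Lemma min_hom_ex V beta : exists W : Rep_of beta, min_hom V W.
Proof.
pose P n := `[< exists W : Rep_of beta, \dim (Hom_Q V W) = n >].
have exP : exists n, P n.
  by eexists; apply/asboolP; exists (fun=> 0).
case: (ex_minnP exP) => n /asboolP[W <-] minW; exists W => W'.
by apply: minW; apply/asboolP; exists W'.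
Qed.

Definition ext V beta : nat := dim_Ext V (projT1 (cid (min_hom_ex V beta))).

Lemma ext_min_hom V beta (W : Rep_of beta) : min_hom V W -> ext V beta = dim_Ext V W.
Proof.
rewrite /ext; case: cid => W0 /= W0min Wmin.
have homE : \dim (Hom_Q V W0) = \dim (Hom_Q V W).
  by apply/eqP; rewrite eqn_leq W0min Wmin.
have := dim_Hom_Ext V W; rewrite -homE.
by rewrite (dim_Hom_Ext V W0) => /addnI.
Qed.

Definition ncext_seq (R : realType) V beta (d : nat) : R :=
  (ext V (fun x => d * beta x)%N)%:R / d%:R.

Definition ncext (R : realType) V beta : R := limn (ncext_seq R V beta).

End Representations.

Definition is_max (R : realType) (A : set R) (m : R) : Prop := A m /\ ubound A m.

(* Main.v *)
(* Write chi(U) = <dim U, beta> and let k be the infimum of dim Hom(V, W) / d *)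
(* over all d > 0 and all W of dimension vector d beta. As dim Ext = dim Hom  *)
(* - d chi(V), direct sums make the limit exist and equal k - chi(V). Since   *)
(* Ext(V, W) maps onto Ext(U, W) for U in V, the limit is at least -chi(U).   *)
(* For the converse, induct on dim V to find U with k <= chi(V) - chi(U); if  *)
(* k = 0, take U = V.                                                         *)
(*                                                                            *)
(* Let k > 0 and let W be almost optimal for V. Choose a subrepresentation K  *)
(* such that the maps V -> W vanishing on K have small codimension in Hom(V,  *)
(* W), while every v outside K has a large space of values under these maps;  *)
(* K is proper because dim Hom(V, W) >= d k. With n = dim V, the second       *)
(* property yields r maps V -> W^n vanishing on K, r a fixed fraction of d,   *)
(* that together embed (V / K)^r in W^n; hence r arbitrary arrow maps V / K   *)
(* -> W are restrictions of one arrow map Z on W^n. If the kernel of Ext(V,   *)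
(* W) -> Ext(K, W) were large, deforming W^n along Z over F[t]/t^m would, as  *)
(* m grows, beat the infimum k. So this kernel is small.                      *)
(*                                                                            *)
(* To compare with the infimum for K, replace W by the sum of a power of W    *)
(* and of a representation almost optimal for V and K at once, obtained by    *)
(* interpolating between W and an almost optimal one for K, again over        *)
(* F[t]/t^m. The hypotheses on K survive, and the two estimates give k -      *)
(* chi(V) <= k_K - chi(K) up to a small error, which is harmless because chi  *)
(* takes integer values. Letting m grow avoids any assumption on the size of  *)
(* F.                                                                         *)

(* In this outline k is [nchom V] and chi(U) is [euler (subdim U) beta]. The lower bound is
   [ncext_seq_ge], from the count of Ext groups in [dim_Ext_sub]; the converse is [nchom_subrep], by
   induction through [nchom_step]. [robust_subrep] chooses K, [rank_loss] bounds the kernel of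
   Ext(V, W) -> Ext(K, W), and [simultaneous_approx] supplies the summand almost optimal for V and
   K. All the representations over F[t]/t^m come from [mix_ex].

   The sum works by a cancellation. Let Y have dimension vector 2 N beta, half of it from W and half
   from that summand X. Up to small errors, 2 N k <= dim Hom(V, Y) = dim Hom(K, Y) + 2 N (chi(V) -
   chi(K)), as the kernel is small, while dim Hom(K, Y) <= N (k - chi(V) + chi(K)) + N k_K. Removing
   N k leaves k <= chi(V) - chi(K) + k_K. *)
From HB Require Import structures.
Require Import Defs.
From mathcomp Require Import all_boot all_order all_algebra.
From mathcomp Require Import all_classical all_reals all_analysis.
From mathcomp Require Import zify ring lra.

Set Implicit Arguments.
Unset Strict Implicit.
Unset Printing Implicit Defensive.

Import Order.TTheory GRing.Theory Num.Theory.
Import numFieldNormedType.Exports.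
Import VectorInternalTheory.

Local Open Scope classical_set_scope.
Local Open Scope ring_scope.

(** * Linear algebra *)

Lemma dim_dprodv (F : fieldType) (I : finType) (V : I -> vectType F) :
  dim (dprodv V) = (\sum_i dim (V i))%N.
Proof.
rewrite [LHS]/dim /= (reindex (@enum_val I predT)) /=; first exact: eq_bigl.
exact: onW_bij (enum_val_bij I).
Qed.

Lemma dim_hom (F : fieldType) (U V : vectType F) :
  dim 'Hom(U, V) = (dim U * dim V)%N.
Proof. by []. Qed.

Section LinearAlgebra.
Variable F : fieldType.

Lemma dim_le_ker (U X : vectType F) (f : 'Hom(U, X)) (S : {vspace U}) T H :
  (f @: S <= T)%VS -> (S :&: lker f <= H)%VS -> (\dim S <= \dim T + \dim H)%N.
Proof.
by move=> fS kS; rewrite -(limg_ker_dim f S) addnC leq_add ?dimvS.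
Qed.

Lemma dim_preim (U X : vectType F) (f : 'Hom(U, X)) (S : {vspace X}) :
  \dim (f @^-1: S) = (\dim (lker f) + \dim (S :&: limg f))%N.
Proof.
rewrite -(limg_ker_dim f (f @^-1: S)) -[in RHS](lpreimK (capvSr S (limg f))).
rewrite lpreim_cap_limg; congr (\dim _ + _)%N; apply/capv_idPr.
by apply/subvP => u; rewrite -memv_preim memv_ker => /eqP ->; exact: mem0v.
Qed.

(** The [f i] together embed [S] in the product of the [T i]. *)
Lemma joint_ker_dim (I : finType) (U : vectType F) (X : I -> vectType F)
    (f : forall i, 'Hom(U, X i)) (S : {vspace U}) (T : forall i, {vspace X i}) :
  (forall i, (f i @: S <= T i)%VS) ->
  (forall u, u \in S -> (forall i, f i u = 0) -> u = 0) ->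
  (\dim S <= \sum_i \dim (T i))%N.
Proof.
move=> fS f0.
have gL : linear (fun u => [ffun i => f i u] : dprodv X).
  by move=> c u v; apply/ffunP => i; rewrite dpvDE dpvZE !ffunE linearP.
pose g := linmap gL.
have gE u i : g u i = f i u by rewrite linmapE ffunE.
have hL : linear (fun t : dprodv (fun i => subvs_of (T i)) =>
    [ffun i => vsval (t i)] : dprodv X).
  by move=> c u v; apply/ffunP => i; rewrite dpvDE dpvZE !ffunE.
pose h := linmap hL.
have hE u i : h u i = vsval (u i) by rewrite linmapE ffunE.
have -> : (\sum_i \dim (T i))%N = dim (dprodv (fun i => subvs_of (T i))).
  by rewrite dim_dprodv.
rewrite -dimvf -(@limg_dim_eq _ _ _ g S).
  apply: leq_trans (_ : \dim (limg h) <= _)%N; last first.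
    by rewrite -(limg_ker_dim h fullv) leq_addl.
  apply/dimvS/subvP => _ /memv_imgP[u uS ->]; apply/memv_imgP.
  exists ([ffun i => vsproj (T i) (f i u)]
            : dprodv (fun i => subvs_of (T i))); first exact: memvf.
  apply/ffunP => i; rewrite hE gE ffunE vsprojK //.
  by apply: (subvP (fS i)); exact: memv_img.
apply/eqP; rewrite -subv0; apply/subvP => u.
rewrite memv_cap memv_ker memv0 => /andP[uS /eqP gu]; apply/eqP/f0 => // i.
by rewrite -gE gu dpv0E.
Qed.

End LinearAlgebra.

(** * Spaces of maps *)

Section VertexMaps.
Variables (F : fieldType) (Q : quiver).
Implicit Types V W X : rep F Q.

Lemma vmapP V W (f g : vertex_maps V W) :
  (forall x v, f x v = g x v) -> f = g.
Proof. by move=> fg; apply/ffunP => x; apply/lfunP => v; exact: fg. Qed.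

Lemma amapP V W (f g : arrow_maps V W) :
  (forall a v, f a v = g a v) -> f = g.
Proof. by move=> fg; apply/ffunP => x; apply/lfunP => v; exact: fg. Qed.

Definition comm V W : 'Hom(vertex_maps V W, arrow_maps V W) :=
  linfun (@commutator F Q V W).

Lemma commE V W (f : vertex_maps V W) a v :
  comm V W f a v = f (hd a) (rmap V a v) - rmap W a (f (tl a) v).
Proof. by rewrite lfunE /= ffunE add_lfunE opp_lfunE !comp_lfunE. Qed.

Lemma morphP V W (f : vertex_maps V W) : f \in Hom_Q V W -> morph f.
Proof. by move/mem_Hom_Q. Qed.

Definition vpost V W X (g : forall x, 'Hom(W x, X x)) (f : vertex_maps V W) :
  vertex_maps V X := [ffun x => (g x \o f x)%VF].

Lemma vpostE V W X g (f : vertex_maps V W) x v :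
  vpost (X := X) g f x v = g x (f x v).
Proof. by rewrite ffunE comp_lfunE. Qed.

Fact vpost_is_linear V W X g : linear (@vpost V W X g).
Proof.
move=> c f f'; apply: vmapP => x v.
by rewrite !(dpvDE, dpvZE, add_lfunE, scale_lfunE, vpostE, linearP).
Qed.
HB.instance Definition _ V W X g := GRing.isLinear.Build F
  (vertex_maps V W) (vertex_maps V X) *:%R (@vpost V W X g)
  (@vpost_is_linear V W X g).

Definition apost V W X (g : forall x, 'Hom(W x, X x)) (f : arrow_maps V W) :
  arrow_maps V X := [ffun a => (g (hd a) \o f a)%VF].

Lemma apostE V W X g (f : arrow_maps V W) a v :
  apost (X := X) g f a v = g (hd a) (f a v).
Proof. by rewrite ffunE comp_lfunE. Qed.

Fact apost_is_linear V W X g : linear (@apost V W X g).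
Proof.
move=> c f f'; apply: amapP => x v.
by rewrite !(dpvDE, dpvZE, add_lfunE, scale_lfunE, apostE, linearP).
Qed.
HB.instance Definition _ V W X g := GRing.isLinear.Build F
  (arrow_maps V W) (arrow_maps V X) *:%R (@apost V W X g)
  (@apost_is_linear V W X g).

Definition vpre V W X (g : forall x, 'Hom(X x, V x)) (f : vertex_maps V W) :
  vertex_maps X W := [ffun x => (f x \o g x)%VF].

Lemma vpreE V W X g (f : vertex_maps V W) x v :
  vpre (X := X) g f x v = f x (g x v).
Proof. by rewrite ffunE comp_lfunE. Qed.

Fact vpre_is_linear V W X g : linear (@vpre V W X g).
Proof.
move=> c f f'; apply: vmapP => x v.
by rewrite !(dpvDE, dpvZE, add_lfunE, scale_lfunE, vpreE, linearP).
Qed.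
HB.instance Definition _ V W X g := GRing.isLinear.Build F
  (vertex_maps V W) (vertex_maps X W) *:%R (@vpre V W X g)
  (@vpre_is_linear V W X g).

Definition apre V W X (g : forall x, 'Hom(X x, V x)) (f : arrow_maps V W) :
  arrow_maps X W := [ffun a => (f a \o g (tl a))%VF].

Lemma apreE V W X g (f : arrow_maps V W) a v :
  apre (X := X) g f a v = f a (g (tl a) v).
Proof. by rewrite ffunE comp_lfunE. Qed.

Fact apre_is_linear V W X g : linear (@apre V W X g).
Proof.
move=> c f f'; apply: amapP => x v.
by rewrite !(dpvDE, dpvZE, add_lfunE, scale_lfunE, apreE, linearP).
Qed.
HB.instance Definition _ V W X g := GRing.isLinear.Build F
  (arrow_maps V W) (arrow_maps X W) *:%R (@apre V W X g)
  (@apre_is_linear V W X g).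

Lemma comm_vpost V W X (g : forall x, 'Hom(W x, X x)) f :
  @morph F Q W X g -> comm V X (vpost g f) = apost g (comm V W f).
Proof.
move=> gM; apply: amapP => a v.
by rewrite commE apostE !vpostE commE linearB /= gM.
Qed.

Lemma comm_vpre V W X (g : forall x, 'Hom(X x, V x)) f :
  @morph F Q X V g -> comm X W (vpre g f) = apre g (comm V W f).
Proof.
by move=> gM; apply: amapP => a v; rewrite commE apreE !vpreE commE gM.
Qed.

Lemma Hom_Q_vpost V W X (g : forall x, 'Hom(W x, X x)) f :
  @morph F Q W X g -> f \in Hom_Q V W -> vpost g f \in Hom_Q V X.
Proof.
move=> gM /morphP fM; apply/mem_Hom_Q => a v.
by rewrite !vpostE fM gM.
Qed.

Definition ev V W x (v : V x) (f : vertex_maps V W) : W x := f x v.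

Fact ev_is_linear V W x (v : V x) : linear (@ev V W x v).
Proof. by move=> c f f'; rewrite /ev dpvDE dpvZE add_lfunE scale_lfunE. Qed.
HB.instance Definition _ V W x v := GRing.isLinear.Build F
  (vertex_maps V W) (W x) *:%R (@ev V W x v) (@ev_is_linear V W x v).

Lemma hom_dsum_le (I : finType) V (W : I -> rep F Q) X
    (pr : forall i x, 'Hom(X x, W i x)) :
  (forall i, @morph F Q X (W i) (pr i)) ->
  (forall x u, (forall i, pr i x u = 0) -> u = 0) ->
  (\dim (Hom_Q V X) <= \sum_i \dim (Hom_Q V (W i)))%N.
Proof.
move=> prM pr0.
apply: (@joint_ker_dim _ _ _ (fun i => vertex_maps V (W i))
  (fun i => linfun (vpost (pr i)))) => [i|f _ f0].
  apply/subvP => _ /memv_imgP[f fH ->]; rewrite lfunE /=.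
  exact: Hom_Q_vpost.
apply: vmapP => x v; rewrite dpv0E zero_lfunE; apply: pr0 => i.
by have := f0 i; rewrite lfunE /= -vpostE => ->; rewrite dpv0E zero_lfunE.
Qed.

Lemma hom_inj_le V W X (g : forall x, 'Hom(W x, X x)) :
  @morph F Q W X g -> (forall x, injective (g x)) ->
  (\dim (Hom_Q V W) <= \dim (Hom_Q V X))%N.
Proof.
move=> gM gI.
have := @hom_dsum_le unit V (fun=> X) W (fun=> g) (fun=> gM).
rewrite big_const card_unit /= addn0; apply=> x u /(_ tt) gu.
by apply: gI; rewrite gu linear0.
Qed.

End VertexMaps.

(** * Powers, sums and subrepresentations *)

Section Constructions.
Variables (F : fieldType) (Q : quiver).
Implicit Types V W X : rep F Q.

Section Power.
Variables (W : rep F Q) (n : nat).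

Fact pow_map_is_linear a : linear (fun f : {ffun 'I_n -> W (tl a)} =>
  [ffun i => rmap W a (f i)] : {ffun 'I_n -> W (hd a)}).
Proof. by move=> c f g; apply/ffunP => i; rewrite !ffunE linearP. Qed.

Definition pow : rep F Q :=
  @Rep F Q (fun x => {ffun 'I_n -> W x} : vectType F)
    (fun a => linmap (@pow_map_is_linear a)).

Lemma pow_mapE a (f : pow (tl a)) : rmap pow a f = [ffun i => rmap W a (f i)].
Proof. exact: linmapE. Qed.

Fact pow_prj_is_linear i x : linear (fun f : {ffun 'I_n -> W x} => f i).
Proof. by move=> c f g; rewrite !ffunE. Qed.

Definition pow_prj i x : 'Hom(pow x, W x) := linmap (@pow_prj_is_linear i x).

Lemma pow_prjE i x (f : pow x) : pow_prj i x f = (f : {ffun _}) i.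
Proof. exact: linmapE. Qed.

Lemma pow_prj_morph i : @morph F Q pow W (pow_prj i).
Proof. by move=> a f; rewrite !pow_prjE pow_mapE ffunE. Qed.

Lemma dim_pow x : dim (pow x) = (n * dim (W x))%N.
Proof. by rewrite [LHS]/dim /= card_ord. Qed.

Lemma hom_pow V : (\dim (Hom_Q V pow) <= n * \dim (Hom_Q V W))%N.
Proof.
have := @hom_dsum_le F Q 'I_n V (fun=> W) pow pow_prj pow_prj_morph.
rewrite sum_nat_const card_ord; apply=> x u u0.
by apply/ffunP => i; rewrite -pow_prjE u0 ffunE.
Qed.

Fact vtup_is_linear V (f : 'I_n -> vertex_maps V W) x :
  linear (fun v => [ffun i => f i x v] : {ffun 'I_n -> W x}).
Proof. by move=> c u v; apply/ffunP => i; rewrite !ffunE linearP. Qed.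

Definition vtup V (f : 'I_n -> vertex_maps V W) : vertex_maps V pow :=
  [ffun x => linmap (@vtup_is_linear V f x)].

Lemma vtupE V (f : 'I_n -> vertex_maps V W) x v :
  vtup f x v = [ffun i => f i x v].
Proof. by rewrite ffunE linmapE. Qed.

Lemma Hom_Q_vtup V (f : 'I_n -> vertex_maps V W) :
  (forall i, f i \in Hom_Q V W) -> vtup f \in Hom_Q V pow.
Proof.
move=> fH; apply/mem_Hom_Q => a v; rewrite pow_mapE !vtupE.
by apply/ffunP => i; rewrite !ffunE (morphP (fH i)).
Qed.

End Power.

Definition dsum W W' : rep F Q := coc_rep (0 : arrow_maps W' W).

Lemma dim_dsum W W' x : dim (dsum W W' x) = (dim (W x) + dim (W' x))%N.
Proof. by []. Qed.

Lemma dsumE W W' a u : rmap (dsum W W') a u = (rmap W a u.1, rmap W' a u.2).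
Proof. by rewrite coc_repE /coc_fun dpv0E zero_lfunE addr0. Qed.

Fact fst_is_linear (U U' : vectType F) : linear (fun u : (U * U')%type => u.1).
Proof. by []. Qed.

Lemma hom_dsum V W W' :
  (\dim (Hom_Q V (dsum W W')) <= \dim (Hom_Q V W) + \dim (Hom_Q V W'))%N.
Proof.
pose pr (b : bool) x : 'Hom(dsum W W' x, (if b then W else W') x) :=
  if b return 'Hom(dsum W W' x, (if b then W else W') x)
  then linmap (@fst_is_linear (W x) (W' x)) else coc_prj W' W x.
have := @hom_dsum_le F Q bool V (fun b => if b then W else W') (dsum W W') pr.
rewrite big_bool /=; apply.
  by case=> a u; rewrite dsumE /pr !linmapE.
move=> x [u u'] u0; have := u0 true; have := u0 false.
by rewrite /pr !linmapE /= => -> ->.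
Qed.

(** For a subrepresentation K, [van] and [avan] stand for the morphisms and the arrow maps from V /
    K to W, kept inside the maps from V. *)
Definition van V W (K : forall x, {vspace V x}) : {vspace vertex_maps V W} :=
  (Hom_Q V W :&: lker (linfun (@vpre F Q V W V (fun x => projv (K x)))))%VS.

Definition avan V W (K : forall x, {vspace V x}) : {vspace arrow_maps V W} :=
  lker (linfun (@apre F Q V W V (fun x => projv (K x)))).

Lemma vanP V W (K : forall x, {vspace V x}) (f : vertex_maps V W) :
  reflect (f \in Hom_Q V W /\ forall x v, v \in K x -> f x v = 0)
          (f \in van W K).
Proof.
rewrite memv_cap [X in _ && X]memv_ker lfunE /=.
apply: (iffP andP) => -[fH f0]; split=> //.
  move=> x v vK.
  have := congr1 (fun g : vertex_maps V W => g x v) (eqP f0).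
  by rewrite vpreE projv_id // dpv0E zero_lfunE.
apply/eqP/vmapP => x v; rewrite vpreE dpv0E zero_lfunE; apply: f0.
exact: memv_proj.
Qed.

Lemma avanP V W (K : forall x, {vspace V x}) (f : arrow_maps V W) :
  reflect (forall a v, v \in K (tl a) -> f a v = 0) (f \in avan W K).
Proof.
rewrite memv_ker lfunE /=; apply: (iffP eqP) => [f0 a v vK|f0].
  have := congr1 (fun g : arrow_maps V W => g a v) f0.
  by rewrite apreE projv_id // dpv0E zero_lfunE.
apply/amapP => x v; rewrite apreE dpv0E zero_lfunE; apply: f0.
exact: memv_proj.
Qed.

(** A large value means that no small subspace of [W x] absorbs all images of v; this survives
    adding summands to W. *)
Definition evdim V W (K : forall x, {vspace V x}) x (v : V x) : nat :=
  \dim (linfun (@ev F Q V W x v) @: van W K)%VS.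

Lemma evdim_inj V W X (K : forall x, {vspace V x}) x (v : V x)
    (g : forall x, 'Hom(W x, X x)) :
  @morph F Q W X g -> (forall x, injective (g x)) ->
  (evdim W K v <= evdim X K v)%N.
Proof.
move=> gM gI; rewrite /evdim -(@limg_dim_eq _ _ _ (g x)); last first.
  have /eqP -> : lker (g x) == 0%VS by apply/lker0P.
  by rewrite capv0.
apply/dimvS/subvP => _ /memv_imgP[_ /memv_imgP[f /vanP[fH f0] ->] ->].
apply/memv_imgP; exists (vpost g f); last by rewrite !lfunE /= /ev vpostE.
apply/vanP; split; first exact: Hom_Q_vpost.
by move=> y w wK; rewrite vpostE f0 // linear0.
Qed.

Lemma evdim_dsum V W W' (K : forall x, {vspace V x}) x (v : V x) :
  (evdim W K v <= evdim (dsum W W') K v)%N.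
Proof.
apply: (evdim_inj _ _ (coc_inj_morph _)) => y.
by apply/lker0P/eqP; exact: coc_inj_ker0.
Qed.

Lemma evdim_pow V W (K : forall x, {vspace V x}) x (v : V x) n :
  (n * evdim W K v <= evdim (pow W n) K v)%N.
Proof.
rewrite /evdim; set E := lfun_img _ _; set E' := lfun_img _ _.
have hL : linear (fun t : {ffun 'I_n -> subvs_of E} =>
    [ffun i => vsval (t i)] : pow W n x).
  by move=> c u w; apply/ffunP => i; rewrite !ffunE.
have hI : lker (linmap hL) == 0%VS.
  apply/lker0P => s t; rewrite !linmapE => /ffunP st; apply/ffunP => i.
  by have := st i; rewrite !ffunE => /subvs_inj.
have -> : (n * \dim E)%N = \dim (limg (linmap hL)).
  rewrite limg_dim_eq ?(eqP hI) ?capv0 // dimvf [in RHS]/dim /= card_ord.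
  by [].
apply/dimvS/subvP => _ /memv_imgP[t _ ->].
have /fin_all_exists2[f fK ft] : forall i : 'I_n,
    exists2 f, f \in van W K & vsval (t i) = f x v.
  move=> i; have /memv_imgP[f fK ->] := subvsP (t i).
  by exists f; rewrite // lfunE.
apply/memv_imgP; exists (vtup f).
  apply/vanP; split; first by apply: Hom_Q_vtup => i; case/vanP: (fK i).
  move=> y w wK; rewrite vtupE; apply/ffunP => i; rewrite !ffunE.
  by case/vanP: (fK i) => _ ->.
rewrite linmapE lfunE /= /ev vtupE; apply/ffunP => i; rewrite !ffunE.
exact: ft.
Qed.

Section Subrepresentation.
Variables (V : rep F Q) (K : forall x, {vspace V x}) (KS : subrep K).

Definition sub_rep : rep F Q :=
  @Rep F Q (fun x => subvs_of (K x) : vectType F)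
    (fun a => (linfun (vsproj (K (hd a))) \o (rmap V a \o linfun vsval))%VF).

Definition sub_inc x : 'Hom(sub_rep x, V x) := linfun vsval.
Definition sub_ret x : 'Hom(V x, sub_rep x) := linfun (vsproj (K x)).

Lemma sub_incK x u : sub_ret x (sub_inc x u) = u.
Proof. by rewrite !lfunE /= vsvalK. Qed.

Lemma sub_retK x v : v \in K x -> sub_inc x (sub_ret x v) = v.
Proof. by move=> vK; rewrite !lfunE /= vsprojK. Qed.

Lemma sub_inc_mem x u : sub_inc x u \in K x.
Proof. by rewrite lfunE; exact: subvsP. Qed.

Lemma sub_inc_morph : @morph F Q sub_rep V sub_inc.
Proof.
move=> a u; rewrite /= /sub_inc comp_lfunE comp_lfunE !lfunE /= vsprojK //.
by apply: (subvP (KS a)); rewrite memv_img // subvsP.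
Qed.

End Subrepresentation.

Lemma dim_ExtC V W : (\dim (limg (comm V W)) + dim_Ext V W)%N = dim (arrow_maps V W).
Proof.
have -> : dim_Ext V W = \dim ((limg (comm V W))^C)%VS.
  by apply/esym/dim_ExtE/Ext_has_dimP.
by rewrite dimv_compl -dimvf subnKC // dimvS // subvf.
Qed.

(** Restriction to K is onto on vertex maps and on arrow maps and commutes with [comm], so it is
    onto on the cokernels Ext. The last summand is the dimension of its kernel, the classes of arrow
    maps vanishing on K. *)
Lemma dim_Ext_sub V W (K : forall x, {vspace V x}) (KS : subrep K) :
  dim_Ext V W =
  (dim_Ext (sub_rep K) W + \dim (avan W K :\: limg (comm V W)))%N.
Proof.
pose S := sub_rep K.
pose ra : 'Hom(arrow_maps V W, arrow_maps S W) :=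
  linfun (apre (@sub_inc V K)).
pose rv : 'Hom(vertex_maps V W, vertex_maps S W) :=
  linfun (vpre (@sub_inc V K)).
have raE f : ra f = apre (@sub_inc V K) f by rewrite lfunE.
have rvE f : rv f = vpre (@sub_inc V K) f by rewrite lfunE.
have raS : limg ra = fullv.
  apply/vspaceP => f; rewrite memvf; apply/memv_imgP.
  exists (apre (@sub_ret V K) f); rewrite ?memvf // lfunE.
  by apply: amapP => a v; rewrite !apreE sub_incK.
have rvS : limg rv = fullv.
  apply/vspaceP => f; rewrite memvf; apply/memv_imgP.
  exists (vpre (@sub_ret V K) f); rewrite ?memvf // lfunE.
  by apply: vmapP => a v; rewrite !vpreE sub_incK.
have raK : lker ra = avan W K.
  apply/vspaceP => f; rewrite memv_ker lfunE /=; apply/eqP/avanP => [f0 a v vK|f0].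
    have := congr1 (fun g : arrow_maps S W => g a (sub_ret K (tl a) v)) f0.
    by rewrite apreE sub_retK // dpv0E zero_lfunE.
  apply: (@amapP F Q S W) => a v; rewrite apreE dpv0E zero_lfunE f0 //.
  exact: sub_inc_mem.
have rac : (ra @: limg (comm V W))%VS = limg (comm S W).
  rewrite -rvS. rewrite -!limg_comp. apply: eq_in_limg => f _.
  by rewrite !comp_lfunE raE rvE comm_vpre //; exact: sub_inc_morph.
have := limg_ker_dim ra (limg (comm V W)); rewrite rac raK.
have := limg_ker_dim ra fullv; rewrite raS raK capfv !dimvf.
have := dimv_cap_compl (avan W K) (limg (comm V W)).
rewrite [(limg _ :&: _)%VS]capvC -!dim_ExtC -/S.
move=> e1 e2 e3; apply: (@addnI (\dim (limg (comm V W)))).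
by rewrite -e2 -e1 -[in RHS]e3 addnACA [in LHS](addnC (\dim (_ :\: _))).
Qed.

End Constructions.

(** * Mixing two representations on the same spaces *)

Section Mixing.
Variables (F : fieldType) (Q : quiver) (W : rep F Q).
Variable D : forall a, 'Hom(W (tl a), W (hd a)).
Implicit Types (V R : rep F Q).

Definition alt_rep : rep F Q := @Rep F Q W D.

Local Notation comm1 V := (comm V W).
Definition comm2 V : 'Hom(vertex_maps V W, arrow_maps V W) := comm V alt_rep.

Lemma comm2E V (f : vertex_maps V W) a v :
  comm2 V f a v = f (hd a) (rmap V a v) - D a (f (tl a) v).
Proof. exact: (@commE F Q V alt_rep). Qed.

(** The rank of the map that [comm2] induces from Hom(V, W) to Ext(V, W), the cokernel of
    [comm1]. *)
Definition jump V : nat :=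
  (\dim (comm2 V @: Hom_Q V W + limg (comm1 V)) - \dim (limg (comm1 V)))%N.

Definition last_maps V R (l : forall x, 'Hom(R x, W x)) :
  {vspace vertex_maps V W} := (linfun (vpost l) @: Hom_Q V R)%VS.

(* Iterating the extension by [mix_xi] [m] times gives a representation on    *)
(* [W^m] whose maps from [V] are the families with [comm1 f_i + comm2 f_(i-1) *)
(* = 0]: it interpolates between [W] and [alt_rep] over [F[t]/t^m]. The first *)
(* nonzero [f_i] lies in the kernel of [comm1] and, except at the end, the    *)
(* last one in that of [comm2], so the dimension is at most about [m] times   *)
(* that of the smaller kernel.                                                *)
Definition mix_xi R (l : forall x, 'Hom(R x, W x)) : arrow_maps R W :=
  [ffun a => ((D a \o l (tl a)) - (l (hd a) \o rmap R a))%VF].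

(** A morphism from V to R' is a pair (u, f) with f in Hom(V, R) and [comm1] u = - [comm2] (l f).
    Thus [comm2] (l f) lies in the image of [comm1], and f determines u up to Hom(V, W): this is the
    first bound. Every u with [comm1] u in [comm2] L occurs, and f = 0 allows all of Hom(V, W):
    these are the other two. *)
Lemma mix_step V R (l : forall x, 'Hom(R x, W x)) :
  let R' := coc_rep (mix_xi l) in
  let l' : forall x, 'Hom(R' x, W x) := fun x => linmap (@fst_is_linear F (W x) (R x)) in
  let L := last_maps V l in let L' := last_maps V l' in
  [/\ (\dim (Hom_Q V R') + \dim (comm2 V @: L) <=
         \dim (Hom_Q V W) + \dim (Hom_Q V R)
           + \dim (comm2 V @: L :&: limg (comm1 V)))%N,
      (\dim (Hom_Q V W) + \dim (comm2 V @: L :&: limg (comm1 V)) <= \dim L')%N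
    & (Hom_Q V W <= L')%VS].
Proof.
move=> R' l' L L'.
have l'E x (u : (W x * R x)%type) : l' x u = u.1 by rewrite linmapE.
have mixE a (u : R' (tl a)) : rmap R' a u =
    (rmap W a u.1 + (D a (l _ u.2) - l _ (rmap R a u.2)), rmap R a u.2).
  by rewrite coc_repE /coc_fun ffunE add_lfunE opp_lfunE !comp_lfunE.
pose pr : 'Hom(vertex_maps V R', vertex_maps V R) :=
  linfun (@vpost F Q V R' R (coc_prj R W)).
have prE f x v : pr f x v = (f x v).2 by rewrite lfunE /= vpostE linmapE.
pose lp : 'Hom(vertex_maps V R', vertex_maps V W) := linfun (@vpost F Q V R' W l').
have lpE f x v : lp f x v = (f x v).1 by rewrite lfunE /= vpostE l'E.
pose g : 'Hom(vertex_maps V R, arrow_maps V W) :=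
  (comm2 V \o linfun (@vpost F Q V R W l))%VF.
have gE f : g f = comm2 V (vpost l f) by rewrite comp_lfunE lfunE.
have HomR' f : (f \in Hom_Q V R') <->
    (pr f \in Hom_Q V R) /\ comm1 V (lp f) = - g (pr f).
  split=> [/morphP fM|[/morphP prM cE]].
    have fE a v : f (hd a) (rmap V a v) = rmap R' a (f (tl a) v) by exact: fM.
    split; first by apply/mem_Hom_Q => a v; rewrite !prE fE mixE.
    apply: amapP => a v.
    rewrite commE dpvNE opp_lfunE gE comm2E !vpostE !lpE !prE fE mixE /=.
    by rewrite addrAC subrr add0r opprB.
  apply/mem_Hom_Q => a v; rewrite mixE.
  have := congr1 (fun h : arrow_maps V W => h a v) cE.
  rewrite commE dpvNE opp_lfunE gE comm2E !vpostE !lpE !prE.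
  have := prM a v; rewrite !prE => prv; rewrite -prv.
  move=> /eqP; rewrite subr_eq => /eqP fe.
  by rewrite [LHS]surjective_pairing fe opprB addrC.
have mkR' u f : exists f', lp f' = u /\ pr f' = f.
  have hL x : linear (fun v => (u x v, f x v) : R' x).
    by move=> c v v'; congr (_, _); rewrite linearP.
  exists ([ffun x => linmap (hL x)] : vertex_maps V R'); split.
    by apply: vmapP => x v; rewrite lpE ffunE linmapE.
  by apply: vmapP => x v; rewrite prE ffunE linmapE.
have gHom : (g @: Hom_Q V R)%VS = (comm2 V @: L)%VS by rewrite limg_comp.
have gN f : g (- f) = - g f by rewrite linearN.
have prHom : (pr @: Hom_Q V R' <=
    Hom_Q V R :&: g @^-1: limg (comm1 V))%VS.
  apply/subvP => _ /memv_imgP[f /HomR'[fR fW] ->].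
  by rewrite memv_cap fR -memv_preim -[g _]opprK -fW rpredN memv_img ?memvf.
have kerHom : (\dim (Hom_Q V R' :&: lker pr) <= \dim (Hom_Q V W))%N.
  rewrite -(@limg_dim_eq _ _ _ lp).
    apply/dimvS/subvP => _ /memv_imgP[f fK ->].
    move: fK; rewrite memv_cap memv_ker => /andP[/HomR'[_ fW] /eqP f0].
    by apply/mem_Hom_Q; rewrite -mem_Hom_Q memv_ker -/(comm1 V) fW f0 linear0 oppr0.
  apply/eqP; rewrite -subv0; apply/subvP => f.
  rewrite !memv_cap !memv_ker => /andP[/andP[_ /eqP f0] /eqP f1].
  rewrite memv0; apply/eqP/vmapP => x v.
  rewrite [LHS]surjective_pairing -prE -lpE f0 f1.
  by rewrite !dpv0E !zero_lfunE.
split.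
- have h1 : (\dim (Hom_Q V R') <= \dim (Hom_Q V W) +
      \dim (Hom_Q V R :&: g @^-1: limg (comm1 V)))%N.
    by rewrite -(limg_ker_dim pr (Hom_Q V R')) leq_add ?dimvS.
  have h2 := limg_ker_dim g (Hom_Q V R).
  have h3 := limg_ker_dim g (Hom_Q V R :&: g @^-1: limg (comm1 V)).
  have e1 : (g @: (Hom_Q V R :&: g @^-1: limg (comm1 V)) =
      comm2 V @: L :&: limg (comm1 V))%VS.
    rewrite -gHom; apply/vspaceP => w; apply/memv_imgP/idP.
      case=> f /memv_capP[fR]; rewrite -memv_preim => fW ->.
      by rewrite memv_cap memv_img.
    rewrite memv_cap => /andP[/memv_imgP[f fR ->] fW].
    by exists f; rewrite // memv_cap -memv_preim fR.
  have e2 : (\dim (Hom_Q V R :&: g @^-1: limg (comm1 V) :&: lker g) <=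
      \dim (Hom_Q V R :&: lker g))%N.
    by rewrite dimvS ?capvS ?capvSl.
  rewrite e1 in h3; rewrite gHom in h2.
  apply: leq_trans (leq_add h1 (leqnn _)) _.
  by rewrite -!addnA leq_add2l -h2 -h3 addnAC leq_add2r leq_add2r.
- have <- := dim_preim (comm1 V) (comm2 V @: L).
  apply/dimvS/subvP => u.
  rewrite -memv_preim => /memv_imgP[w /memv_imgP[f fR wE] uf].
  have {w wE}uf : comm1 V u = g f by rewrite uf wE comp_lfunE.
  have [f' [f'u f'f]] := mkR' u (- f).
  apply/memv_imgP; exists f'; last by rewrite -f'u.
  by apply/HomR'; rewrite f'f f'u rpredN uf gN opprK.
- apply/subvP => u uW; have [f' [f'u f'f]] := mkR' u 0.
  apply/memv_imgP; exists f'; last by rewrite -f'u.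
  apply/HomR'; rewrite f'f f'u mem0v linear0 oppr0; split=> //.
  by apply/eqP; rewrite -memv_ker.
Qed.
End Mixing.

(** * Asymptotic Hom and perturbation *)

Lemma le0_of_bounded_multiples (R : realType) (a b : R) :
  (forall m : nat, m%:R * a <= b) -> a <= 0.
Proof.
move=> ab; rewrite leNgt; apply/negP => a_gt0.
have b_ge0 : 0 <= b by have := ab 0; rewrite mul0r.
have := archi_boundP (divr_ge0 b_ge0 (ltW a_gt0)).
by rewrite ltr_pdivrMr // ltNge ab.
Qed.

Lemma free_mod_dim (F : fieldType) (U : vectType F) r (v : 'I_r -> U)
    (S T : {vspace U}) :
  (forall j, v j \in T) ->
  (forall c : 'I_r -> F, \sum_j c j *: v j \in S -> forall j, c j = 0) ->
  (r + \dim S <= \dim (T + S))%N.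
Proof.
move=> vT v0; pose X := [tuple v j | j < r].
have XE (j : 'I_r) : X`_j = v j by rewrite -tnth_nth tnth_mktuple.
have XF : free X.
  apply/freeP => c c0; apply: v0.
  by under eq_bigr do rewrite -XE; rewrite c0 mem0v.
have XS : (<<X>> :&: S)%VS = 0%VS.
  apply/eqP; rewrite -subv0; apply/subvP => u /memv_capP[uX uS].
  rewrite memv0 (coord_span uX); apply/eqP/big1 => j _.
  rewrite (v0 (fun i => coord X i u)) ?scale0r //.
  by under eq_bigr do rewrite -XE; rewrite -coord_span.
have <- : \dim <<X>> = r.
  by move: XF; rewrite /free size_tuple => /eqP.
rewrite -dimv_disjoint_sum //; apply/dimvS/addvS => //.
by apply/span_subvP => _ /tnthP[j ->]; rewrite tnth_mktuple.
Qed.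

Section Scaled.
Variables (F : fieldType) (Q : quiver).
Implicit Types (V W R : rep F Q) (beta : dimvec Q).

(** One R serves every V. Each extension raises dim Hom by at most the dimension of the kernel of
    [comm2] plus the growth of the space of last maps. Also, once the last maps contain Hom(V, W),
    it gains at most dim Hom(V, W) - [jump]; the first extension, from R = 0, has nothing to lose,
    whence the summand [jump] on the right. *)
Lemma mix_ex W (D : forall a, 'Hom(W (tl a), W (hd a))) m : exists R,
  (forall x, dim (R x) = m * dim (W x))%N /\
  forall V,
    [/\ (\dim (Hom_Q V R) <=
           m * \dim (Hom_Q V (alt_rep D)) + dim (vertex_maps V W))%N
      & (\dim (Hom_Q V R) + m * jump D V <=
           m * \dim (Hom_Q V W) + jump D V)%N].
Proof.
suff [R [l [dR HR]]] : exists R (l : forall x, 'Hom(R x, W x)),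
  (forall x, dim (R x) = m * dim (W x))%N /\
  forall V,
    [/\ (\dim (Hom_Q V R) <=
           m * \dim (Hom_Q V (alt_rep D)) + \dim (last_maps V l))%N,
       (\dim (Hom_Q V R) + m * jump D V <=
           m * \dim (Hom_Q V W) + jump D V)%N,
       m = 0 -> (\dim (Hom_Q V R) <= 0)%N
      & (0 < m)%N -> (Hom_Q V W <= last_maps V l)%VS].
  exists R; split=> // V; have [h1 h2 _ _] := HR V; split=> //.
  by apply: leq_trans h1 _; rewrite leq_add2l -dimvf dimvS ?subvf.
elim: m => [|m [R [l [dR HR]]]].
  exists (pow W 0), (fun=> 0); split=> [x|V]; first exact: dim_pow.
  have := hom_pow W 0 V; rewrite mul0n leqn0 => /eqP ->.
  by split.
exists (coc_rep (mix_xi D l)), (fun x => linmap (@fst_is_linear F (W x) (R x))).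
split=> [x|V]; first by rewrite mulSn -dR.
have [h1 h2 h0 h3] := HR V; have /= := mix_step D V l.
set R' := coc_rep _; set l' := (fun x => linmap _).
set h' := \dim (Hom_Q V R'); set L := last_maps V l.
set L' := last_maps V _.
set a := \dim (comm2 D V @: L)%VS.
set c := \dim (comm2 D V @: L :&: limg (comm V W))%VS => -[s1 s2 s3].
have La : (\dim L <= a + \dim (Hom_Q V (alt_rep D)))%N.
  by apply: (@dim_le_ker _ _ _ (comm2 D V)) => //; exact: capvSr.
have ca : (c <= a)%N by rewrite dimvS ?capvSl.
have arith1 (i i' k1 k2 b e n n' p : nat) : (i <= p + n)%N ->
    (i' + b <= k1 + i + e)%N -> (k1 + e <= n')%N -> (n <= b + k2)%N ->
    (i' <= k2 + p + n')%N by lia.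
have arith2 (i i' k1 b e j p p' : nat) : (i + p <= p' + j)%N ->
    (i' + b <= k1 + i + e)%N -> (j + e <= b)%N ->
    (i' + (j + p) <= k1 + p' + j)%N by lia.
have arith3 (i i' k1 b e j : nat) : (i + 0 <= 0 + j)%N -> (i <= 0)%N ->
    (i' + b <= k1 + i + e)%N -> (e <= b)%N ->
    (i' + (j + 0) <= k1 + 0 + j)%N by lia.
have arith4 (p q r b e : nat) : (q + e = b + r)%N -> (p <= q)%N ->
    (r <= p)%N -> (p - r + e <= b)%N by lia.
split=> //; first by rewrite mulSn; exact: arith1 h1 s1 s2 La.
rewrite !mulSn; have [m0|m_gt0] := posnP m.
  have R0 := h0 m0.
  by move: h2; rewrite m0 !mul0n => h2; exact: arith3 h2 R0 s1 ca.
apply: arith2 h2 s1 _.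
apply: arith4 (dimv_sum_cap (comm2 D V @: L) (limg (comm V W))) _ _.
  by rewrite dimvS // addvS // limgS // h3.
by rewrite dimvS // addvSr.
Qed.

(** Choosing coordinates puts representations of equal dimension vector on the same spaces, as
    mixing requires. *)
Lemma standard_form W (b : dimvec Q) : (forall x, dim (W x) = b x) ->
  exists W' : Rep_of F b, forall V,
    (\dim (Hom_Q V W') <= \dim (Hom_Q V W))%N.
Proof.
move=> /funext <-.
pose g x : 'Hom('rV[F]_(dim (W x)), W x) := linfun r2v.
pose h x : 'Hom(W x, 'rV[F]_(dim (W x))) := linfun v2r.
pose W' : Rep_of F (fun x => dim (W x)) :=
  fun a => (h (hd a) \o rmap W a \o g (tl a))%VF.
exists W' => V; apply: (@hom_inj_le F Q V (to_rep W') W g) => [a v|x u v].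
  by rewrite /= !comp_lfunE !lfunE /= v2rK.
by rewrite !lfunE /=; exact: r2v_inj.
Qed.

Definition scaled_dim beta d W := forall x, dim (W x) = (d * beta x)%N.

Definition chi V beta : int := euler (fun x => dim (V x)) beta.

Lemma hom_chi beta d V W : scaled_dim beta d W ->
  (\dim (Hom_Q V W))%:Z = (dim_Ext V W)%:Z + d%:Z * chi V beta.
Proof.
move=> dW.
have dA : dim (arrow_maps V W) = (d * \sum_a dim (V (tl a)) * beta (hd a))%N.
  rewrite dim_dprodv big_distrr; apply: eq_bigr => a _ /=.
  by rewrite dim_hom dW mulnCA.
have dX : dim (vertex_maps V W) = (d * \sum_x dim (V x) * beta x)%N.
  rewrite dim_dprodv big_distrr; apply: eq_bigr => x _ /=.
  by rewrite dim_hom dW mulnCA.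
have := dim_Hom_Ext V W; rewrite !dimvf dA dX /chi /euler => e.
have -> : \sum_x (dim (V x))%:Z * (beta x)%:Z = (\sum_x dim (V x) * beta x)%N%:Z.
  by rewrite (big_morph Posz PoszD (erefl 0%:Z)); apply: eq_bigr.
have -> : \sum_a (dim (V (tl a)))%:Z * (beta (hd a))%:Z =
    (\sum_a dim (V (tl a)) * beta (hd a))%N%:Z.
  by rewrite (big_morph Posz PoszD (erefl 0%:Z)); apply: eq_bigr.
lia.
Qed.

Lemma scaled_dim_pow beta d n W :
  scaled_dim beta d W -> scaled_dim beta (n * d) (pow W n).
Proof. by move=> dW x; rewrite dim_pow dW mulnA. Qed.

Lemma scaled_dim_dsum beta d d' W W' : scaled_dim beta d W ->
  scaled_dim beta d' W' -> scaled_dim beta (d + d') (dsum W W').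
Proof. by move=> dW dW' x; rewrite dim_dsum dW dW' mulnDl. Qed.

Lemma scaled_dim_ex beta d : exists W, scaled_dim beta d W.
Proof.
exists (to_rep ((fun=> 0) : Rep_of F (fun x => d * beta x)%N)) => x.
exact: mul1n.
Qed.

End Scaled.

Section NcHom.
Variables (R : realType) (F : fieldType) (Q : quiver) (beta : dimvec Q).
Implicit Types (V W : rep F Q).

Definition hom_ratios V : set R := [set z | exists d W,
  [/\ (0 < d)%N, scaled_dim beta d W & z = (\dim (Hom_Q V W))%:R / d%:R]].

Definition nchom V : R := inf (hom_ratios V).

Lemma has_inf_hom_ratios V : has_inf (hom_ratios V).
Proof.
split.
  have [W dW] := @scaled_dim_ex F Q beta 1.
  by exists ((\dim (Hom_Q V W))%:R / 1%:R); exists 1%N, W.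
by exists 0 => _ [d [W [_ _ ->]]]; rewrite divr_ge0.
Qed.

Lemma nchom_ge0 V : 0 <= nchom V.
Proof.
apply: lb_le_inf; first by case: (has_inf_hom_ratios V).
by move=> _ [d [W [_ _ ->]]]; rewrite divr_ge0.
Qed.

Lemma nchom_le V W d : scaled_dim beta d W ->
  d%:R * nchom V <= (\dim (Hom_Q V W))%:R.
Proof.
move=> dW; case: (posnP d) => [->|d_gt0]; first by rewrite mul0r.
rewrite mulrC -ler_pdivlMr ?ltr0n //; apply: ge_inf.
  by case: (has_inf_hom_ratios V).
by exists d, W.
Qed.

Lemma nchom_approx V (e : R) : 0 < e -> exists d W,
  [/\ (0 < d)%N, scaled_dim beta d W
    & (\dim (Hom_Q V W))%:R <= d%:R * (nchom V + e)].
Proof.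
move=> e_gt0; have [_ [d [W [d_gt0 dW ->]]]] :=
  inf_adherent e_gt0 (has_inf_hom_ratios V).
move=> /ltW; rewrite ler_pdivrMr ?ltr0n // mulrC => hW.
by exists d, W.
Qed.

Definition act_arrow V W (Z : forall a, 'Hom(W (tl a), W (hd a)))
    (f : vertex_maps V W) : arrow_maps V W := [ffun a => (Z a \o f (tl a))%VF].

(* Mixing [W] with [W - Z]: on [Hom_Q V W], [comm2] is then [act_arrow Z].    *)
Lemma perturbation V W d (Z : forall a, 'Hom(W (tl a), W (hd a)))
    r (v : 'I_r -> vertex_maps V W) :
  scaled_dim beta d W -> (forall j, v j \in Hom_Q V W) ->
  (forall c : 'I_r -> F,
     \sum_j c j *: act_arrow Z (v j) \in limg (comm V W) -> forall j, c j = 0) ->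
  r%:R + d%:R * nchom V <= (\dim (Hom_Q V W))%:R.
Proof.
move=> dW vH v0; pose D a := rmap W a - Z a.
have DE j : comm2 D V (v j) = act_arrow Z (v j).
  apply: amapP => a u; rewrite comm2E (morphP (vH j)) ffunE comp_lfunE.
  by rewrite add_lfunE opp_lfunE opprB addrC subrK.
have rj : (r <= jump D V)%N.
  rewrite -(leq_add2r (\dim (limg (comm V W)))) subnK ?dimvS ?addvSr //.
  apply: (@free_mod_dim _ _ _ (fun j => act_arrow Z (v j))) => // j.
  by rewrite -DE memv_img.
(* The mixture gives m d [nchom V] <= dim Hom(V, X) <= m dim Hom(V, W) - (m - 1) [jump], so m times
   the defect is at most [jump] for every m. *)
rewrite -subr_le0; apply: (@le0_of_bounded_multiples R _ (jump D V)%:R) => m.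
have [X [dX HX]] := mix_ex D m; have [_ HXV] := HX V.
have /(nchom_le V) : scaled_dim beta (m * d) X.
  by move=> x; rewrite dX dW mulnA.
move: HXV; rewrite -(ler_nat R) !natrD !natrM => h1 h2.
have : m%:R * r%:R <= m%:R * (jump D V)%:R :> R.
  by rewrite ler_wpM2l // ler_nat.
lra.
Qed.

End NcHom.

(** * Maps vanishing on a subrepresentation *)

Lemma lfun_factor (F : fieldType) (A B C : vectType F)
    (f : 'Hom(A, B)) (g : 'Hom(A, C)) :
  (lker f <= lker g)%VS -> exists h : 'Hom(B, C), forall a, h (f a) = g a.
Proof.
move=> /subvP fg; exists (g \o f^-1)%VF => a; rewrite comp_lfunE.
apply/eqP; rewrite -subr_eq0 -linearB -memv_ker; apply: fg.
by rewrite memv_ker linearB /= limg_lfunVK ?memv_img ?memvf // subrr.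
Qed.

Section Robust.
Variables (F : fieldType) (Q : quiver).
Implicit Types (V W : rep F Q).

Definition total_dim V : nat := \sum_x dim (V x).

Lemma dim_le_total V x : (dim (V x) <= total_dim V)%N.
Proof. by rewrite /total_dim (bigD1 x) //= leq_addr. Qed.

(** Greedy choice: if some v outside K is sent into I by all maps chosen so far, its values under
    [van W K] span more than dim I, so a further map moves it out of I. *)
Lemma separating_row V W (K : forall x, {vspace V x})
    (I : forall x, {vspace W x}) :
  (forall x (v : V x), v \notin K x -> (\dim (I x) < evdim W K v)%N) ->
  exists f : 'I_(total_dim V) -> vertex_maps V W,
    (forall k, f k \in van W K) /\
    (forall x (v : V x), (forall k, f k x v \in I x) -> v \in K x).
Proof.
move=> KI.
pose B (t : seq (vertex_maps V W)) x : {vspace V x} :=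
  (\bigcap_(f <- t) (f x @^-1: I x))%VS.
have BP (t : seq (vertex_maps V W)) x (v : V x) :
    reflect (forall f, f \in t -> f x v \in I x) (v \in B t x).
  rewrite /B; elim: t => [|f t IHt].
    by rewrite big_nil memvf; left.
  rewrite big_cons memv_cap -memv_preim; apply: (iffP andP) => [[fI /IHt tI] g|tI].
    by rewrite in_cons => /predU1P[->|/tI].
  split; first by rewrite tI ?mem_head.
  by apply/IHt => g gt; rewrite tI // in_cons gt orbT.
have [t [st tK tB]] : exists t, [/\ size t = total_dim V, {subset t <= van W K}
    & (forall x v, v \in B t x -> v \in K x) \/
      (\sum_x \dim (B t x) + total_dim V <= total_dim V)%N].
  (* After m choices, either they already separate and zero maps pad the list, or [B] has total
     dimension at most [total_dim V] - m, hence is zero at the end. *)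
  elim: {1 2}(total_dim V) => [|m [t [st tK tB]]].
    exists [::]; split=> //; right; rewrite addn0 leq_sum // => x _.
    by rewrite -dimvf dimvS ?subvf.
  have [tB1|tB1] := pselect (forall x v, v \in B t x -> v \in K x).
    exists (0 :: t); split=> [|f|]; rewrite /= ?st //.
      by rewrite in_cons => /predU1P[->|/tK //]; exact: mem0v.
    left=> x v /BP vt; apply/tB1/BP => f ft; apply: vt.
    by rewrite in_cons ft orbT.
  case: tB => // tB.
  have [x [v [vB vK]]] : exists x v, v \in B t x /\ v \notin K x.
    apply: contrapT => no; apply: tB1 => x v vB; apply/negPn/negP => vK.
    by apply: no; exists x, v.
  have [f fK fv] : exists2 f, f \in van W K & f x v \notin I x.
    apply: contrapT => no; have := KI x v vK; rewrite ltnNge => /negP; apply.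
    apply/dimvS/subvP => _ /memv_imgP[f fK ->]; rewrite lfunE /= /ev.
    by apply/negPn/negP => fv; apply: no; exists f.
  exists (f :: t); split=> [|g|]; rewrite /= ?st //.
    by rewrite in_cons => /predU1P[->|/tK].
  right; rewrite addnS -addSn; apply: leq_trans tB; rewrite leq_add2r.
  have Bf y : (B (f :: t) y <= B t y)%VS by rewrite /B big_cons capvSr.
  rewrite (bigD1 x) //= [X in (_ <= X)%N](bigD1 x) //= -addSn leq_add //.
    rewrite ltn_neqAle dimvS // andbT; apply: contra fv => /eqP Bd.
    have : v \in B (f :: t) x.
      by have /eqP -> : B (f :: t) x == B t x by rewrite eqEdim Bf Bd /=.
    by move/BP; apply; rewrite mem_head.
  by apply: leq_sum => y _; rewrite dimvS.
exists (fun k => t`_k); split=> [k|x v vI].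
  by apply: tK; rewrite mem_nth // st.
case: tB => [tB|]; [apply: tB | rewrite -[X in (_ <= X)%N]add0n leq_add2r leqn0].
  apply/BP => f ft; rewrite -(nth_index 0 ft).
  have ti : (index f t < total_dim V)%N by rewrite -st index_mem.
  exact: (vI (Ordinal ti)).
rewrite sum_nat_eq0 => /forallP/(_ x); rewrite dimv_eq0 => /eqP B0.
suff : v \in B t x by rewrite B0 memv0 => /eqP ->; exact: mem0v.
apply/BP => f ft; rewrite -(nth_index 0 ft).
have ti : (index f t < total_dim V)%N by rewrite -st index_mem.
exact: (vI (Ordinal ti)).
Qed.

(** Rows are added one at a time, I being spanned by the images of the earlier ones: at most s rows
    of n maps of rank at most n, with n = [total_dim V]. A relation puts its last entry in K, where
    the new row vanishes, and the earlier rows treat the rest. *)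
Lemma separating_rows V W (K : forall x, {vspace V x}) s r :
  (forall x (v : V x), v \notin K x ->
     (total_dim V * total_dim V * s < evdim W K v)%N) ->
  (r <= s.+1)%N ->
  exists f : nat -> 'I_(total_dim V) -> vertex_maps V W,
    (forall j k, f j k \in van W K) /\
    (forall x (u : nat -> V x), (forall k, \sum_(j < r) f j k x (u j) = 0) ->
       forall j, (j < r)%N -> u j \in K x).
Proof.
move=> KW; elim: r => [|r IHr] rs.
  by exists (fun _ _ => 0); split=> // j k; exact: mem0v.
have [f [fK fI]] := IHr (ltnW rs).
pose I x : {vspace W x} :=
  (\sum_(j < r) \sum_(k < total_dim V) limg (f j k x))%VS.
have II j k x v : (j < r)%N -> f j k x v \in I x.
  move=> jr; apply: (subvP _ _ (memv_img (f j k x) (memvf v))).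
  apply: subv_trans (sumv_sup (Ordinal jr) _ (subvv _)) => //=.
  exact: (sumv_sup k).
have Id x : (\dim (I x) <= total_dim V * total_dim V * s)%N.
  apply: leq_trans (dimv_leq_sum _ _ _ ) _.
  apply: leq_trans (_ : \sum_(j < r) total_dim V * total_dim V <= _)%N.
    apply: leq_sum => j _; apply: leq_trans (dimv_leq_sum _ _ _ ) _.
    rewrite -[X in (_ <= X * _)%N]card_ord -sum_nat_const; apply: leq_sum => k _.
    apply: leq_trans (dim_le_total V x).
    by rewrite -dimvf -(limg_ker_dim (f j k x) fullv) leq_addl.
  have rs' : (r <= s)%N by [].
  by rewrite sum_nat_const card_ord mulnC leq_mul2l rs' orbT.
have [g [gK gI]] := @separating_row V W K I
  (fun x v vK => leq_ltn_trans (Id x) (KW x v vK)).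
exists (fun j => if j == r then g else f j); split=> [j k|x u u0].
  by case: eqP.
have u0' k : \sum_(j < r) f j k x (u j) + g k x (u r) = 0.
  rewrite -[RHS](u0 k) big_ord_recr /= eqxx; congr (_ + _).
  by apply: eq_bigr => j _; rewrite ltn_eqF.
have urK : u r \in K x.
  apply: gI => k; have /eqP := u0' k; rewrite addrC addr_eq0 => /eqP ->.
  by rewrite rpredN; apply: rpred_sum => j _; exact: II.
move=> j; rewrite ltnS leq_eqVlt => /predU1P[->//|jr].
apply: (fI x u _ j jr) => k; rewrite -[RHS](u0' k).
by case/vanP: (gK k) => _ ->; rewrite ?addr0.
Qed.

Definition arrow_at0 W n (i0 : 'I_n) (a : arrow Q)
    (z : 'Hom(pow W n (tl a), W (hd a))) (y : pow W n (tl a)) :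
  pow W n (hd a) := [ffun i => if i == i0 then z y else 0].

Fact arrow_at0_is_linear W n i0 a z : linear (@arrow_at0 W n i0 a z).
Proof.
move=> c y y'; apply/ffunP => i; rewrite !ffunE; case: eqP => _.
  exact: linearP.
by rewrite scaler0 addr0.
Qed.

Lemma free_family (U : vectType F) (S : {vspace U}) r : (r <= \dim S)%N ->
  exists2 f : 'I_r -> U, forall j, f j \in S
    & forall c : 'I_r -> F, \sum_j c j *: f j = 0 -> forall j, c j = 0.
Proof.
move=> rS; pose X := [tuple (vbasis S)`_j | j < r].
have XE (j : 'I_r) : X`_j = (vbasis S)`_j by rewrite -tnth_nth tnth_mktuple.
exists (fun j => X`_j) => [j|].
  by rewrite XE vbasis_mem // mem_nth // size_tuple (leq_trans _ rS).
suff : free X by move/freeP.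
have -> : X = take r (vbasis S) :> seq U.
  apply: (@eq_from_nth _ 0) => [|i].
    by rewrite size_tuple size_take size_tuple; case: ltngtP rS.
  rewrite size_tuple => ir; rewrite nth_take //.
  exact: (XE (Ordinal ir)).
apply: (@catl_free _ _ (drop r (vbasis S))).
by rewrite cat_take_drop (basis_free (vbasisP S)).
Qed.

(** The rows give r morphisms V -> W^n along which a single Z takes r prescribed values in
    [avan W K], chosen independent modulo the image of [comm]. Then [perturbation] applies to
    W^n. *)
Lemma rank_loss (R : realType) beta d V W (K : forall x, {vspace V x}) s :
  (0 < total_dim V)%N -> scaled_dim beta d W ->
  (forall x (v : V x), v \notin K x ->
     (total_dim V * total_dim V * s < evdim W K v)%N) ->
  (minn s.+1 (\dim (avan W K :\: limg (comm V W))))%:R <=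
  (total_dim V)%:R * ((\dim (Hom_Q V W))%:R - d%:R * nchom R beta V).
Proof.
move=> n_gt0 dW KW; set p := \dim _; set r := minn _ _.
set n := total_dim V in n_gt0 *.
have [f [fK fI]] := separating_rows KW (geq_minl s.+1 p).
have [xi xiK xi0] := free_family (geq_minr s.+1 p).
pose v (j : 'I_r) := vtup (f j).
pose i0 := Ordinal n_gt0.
have /fin_all_exists[z zE] : forall a, exists z : 'Hom(pow W n (tl a), W (hd a)),
    forall j u, z (v j _ u) = xi j a u.
  move=> a.
  have pL : linear (fun u : {ffun 'I_r -> V (tl a)} =>
      [ffun k : 'I_n => \sum_(j < r) f j k (tl a) (u j)] : pow W n (tl a)).
    move=> c u u'; apply/ffunP => k; rewrite !ffunE scaler_sumr -big_split.
    by apply: eq_bigr => j _; rewrite !ffunE linearP.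
  have xL : linear (fun u : {ffun 'I_r -> V (tl a)} => \sum_(j < r) xi j a (u j)).
    move=> c u u'; rewrite scaler_sumr -big_split.
    by apply: eq_bigr => j _; rewrite !ffunE linearP.
  (* A tuple killed by all the rows lies in K entrywise, where the [xi j] vanish. *)
  have [|h hE] := @lfun_factor F _ _ _ (linmap pL) (linmap xL).
    apply/subvP => u; rewrite !memv_ker !linmapE => /eqP u0; apply/eqP/big1 => j _.
    have /avanP xiK0 := subvP (diffvSl _ _) _ (xiK j).
    pose u' (i : nat) := oapp (fun i : 'I_r => u i) 0 (insub i).
    have u'E (i : 'I_r) : u' i = u i by rewrite /u' valK.
    apply: xiK0; rewrite -u'E; apply: fI (ltn_ord j) => k.
    have := congr1 (fun y : {ffun 'I_n -> W (tl a)} => y k) u0.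
    by rewrite !ffunE => u0k; under eq_bigr do rewrite u'E.
  exists h => j u.
  pose w : {ffun 'I_r -> V (tl a)} := [ffun i => if i == j then u else 0].
  have := hE w; rewrite !linmapE.
  rewrite [in RHS](bigD1 j) //= ffunE eqxx big1 ?addr0 => [<-|i /negPf ij]; last first.
    by rewrite ffunE ij linear0.
  congr (h _); rewrite vtupE; apply/ffunP => k; rewrite !ffunE.
  rewrite (bigD1 j) //= ffunE eqxx big1 ?addr0 // => i /negPf ij.
  by rewrite ffunE ij linear0.
(* Only coordinate [i0] is perturbed: projecting to it is a morphism and returns [xi j], so a
   relation modulo the image of [comm] on W^n descends to W. *)
pose Z a := linmap (@arrow_at0_is_linear W n i0 a (z a)).
have prZ j : apost (pow_prj W i0) (act_arrow Z (v j)) = xi j.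
  apply: amapP => a u; rewrite apostE pow_prjE ffunE comp_lfunE linmapE.
  by rewrite ffunE eqxx zE.
have : r%:R + (n * d)%:R * nchom R beta V <= (\dim (Hom_Q V (pow W n)))%:R.
  apply: (@perturbation R F Q beta V (pow W n) (n * d) Z r v
    (scaled_dim_pow n dW)) => [j|c cS].
    by apply: Hom_Q_vtup => k; case/vanP: (fK j k).
  apply: xi0; apply/eqP.
  rewrite -memv0 -(capv_diff (avan W K) (limg (comm V W))).
  rewrite memv_cap; apply/andP; split.
    by apply: rpred_sum => j _; rewrite rpredZ.
  case/memv_imgP: cS => g _ gE; apply/memv_imgP.
  exists (vpost (pow_prj W i0) g); first exact: memvf.
  rewrite comm_vpost; last exact: pow_prj_morph.
  rewrite -gE linear_sum; apply: eq_bigr => j _.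
  by rewrite linearZ /= prZ.
have := hom_pow W n V; rewrite -(ler_nat R) !natrM.
by rewrite mulrBr mulrA; lra.
Qed.

End Robust.

Section CommonKernel.
Variables (F : fieldType) (Q : quiver).
Implicit Types (V W : rep F Q).

Definition common_ker V W (N : {vspace vertex_maps V W}) x : {vspace V x} :=
  (\bigcap_(i < \dim N) lker ((vbasis N)`_i x))%VS.

Lemma common_kerP V W (N : {vspace vertex_maps V W}) x (v : V x) :
  reflect (forall f, f \in N -> f x v = 0) (v \in common_ker N x).
Proof.
apply: (iffP idP) => [vN f fN|v0].
  rewrite (coord_vbasis fN) -[LHS]/(ev v _) linear_sum big1 // => i _.
  rewrite linearZ /= /ev.
  have /subv_bigcapP/(_ i isT) : (<[v]> <= common_ker N x)%VS by [].
  by rewrite -memvE memv_ker => /eqP ->; rewrite scaler0.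
rewrite memvE; apply/subv_bigcapP => i _; rewrite -memvE memv_ker.
by apply/eqP/v0; rewrite vbasis_mem // mem_nth // size_tuple.
Qed.

Lemma common_ker_subrep V W (N : {vspace vertex_maps V W}) :
  (N <= Hom_Q V W)%VS -> subrep (common_ker N).
Proof.
move=> /subvP NH a; apply/subvP => _ /memv_imgP[v /common_kerP v0 ->].
by apply/common_kerP => f fN; rewrite (morphP (NH _ fN)) v0 // linear0.
Qed.

(** K has maximal total dimension among the subrepresentations satisfying the last inequality; zero
    is one. If v outside K had [evdim] at most D, imposing f(v) = 0 on [van W K] would cost at most
    D dimensions, and the common kernel of the remaining maps would be a larger choice. *)
Lemma robust_subrep (R : realType) V W (D : R) : 0 <= D ->
  exists K : forall x, {vspace V x}, [/\ subrep K,
    forall x (v : V x), v \notin K x -> D < (evdim W K v)%:R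
  & (\dim (Hom_Q V W))%:R <=
      D * (\sum_x \dim (K x))%N%:R + (\dim (van W K))%:R].
Proof.
move=> D_ge0.
pose good c := `[< exists K : forall x, {vspace V x}, [/\ subrep K,
    c = (\sum_x \dim (K x))%N & (\dim (Hom_Q V W))%:R <=
      D * c%:R + (\dim (van W K))%:R] >].
have ex_good : exists c, good c.
  exists (\sum_(x : vertex Q) \dim (0%VS : {vspace V x}))%N; apply/asboolP.
  exists (fun=> 0%VS); split=> // [a|]; first by rewrite limg0 subvv.
  apply: ler_wpDl; first by rewrite mulr_ge0.
  rewrite ler_nat dimvS //; apply/subvP => f fH; apply/vanP; split=> // x v.
  by rewrite memv0 => /eqP ->; rewrite linear0.
have bound c : good c -> (c <= total_dim V)%N.
  move=> /asboolP[K [_ -> _]]; apply: leq_sum => x _.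
  by rewrite -dimvf dimvS ?subvf.
case: (ex_maxnP ex_good bound) => c /asboolP[K [KS -> Kd]] maxc.
exists K; split=> // x v vK; rewrite ltNge; apply/negP => Dv.
pose e : 'Hom(vertex_maps V W, W x) := linfun (@ev F Q V W x v).
pose N := (van W K :&: lker e)%VS.
have NK f : f \in N -> f \in van W K /\ f x v = 0.
  by move=> /memv_capP[-> /=]; rewrite memv_ker lfunE => /eqP.
have NH : (N <= Hom_Q V W)%VS.
  by apply/subvP => f /NK[/vanP[]].
have cK : (\sum_y \dim (K y) < \sum_y \dim (common_ker N y))%N.
  have Ky y : (K y <= common_ker N y)%VS.
    apply/subvP => w wK; apply/common_kerP => f /NK[/vanP[_ f0] _].
    exact: f0.
  rewrite (bigD1 x) //= [X in (_ < X)%N](bigD1 x) //= -addSn leq_add //.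
    rewrite ltn_neqAle dimvS // andbT; apply: contra vK => /eqP Kd'.
    have /eqP -> : K x == common_ker N x by rewrite eqEdim Ky Kd' /=.
    by apply/common_kerP => f /NK[].
  by apply: leq_sum => y _; rewrite dimvS.
have /maxc : good (\sum_y \dim (common_ker N y))%N.
  apply/asboolP; exists (common_ker N); split=> //; first exact: common_ker_subrep.
  apply: (le_trans Kd); rewrite -(limg_ker_dim e (van W K)) -/N natrD.
  have : (\dim N <= \dim (van W (common_ker N)))%N.
    apply/dimvS/subvP => f fN; apply/vanP; split; first exact: (subvP NH).
    by move=> y w /common_kerP; apply.
  move: cK; rewrite -(ler_nat R) -[(\dim N <= _)%N](ler_nat R) -/e => cK dN.
  have : D * (\sum_y \dim (K y)).+1%:R <= D * (\sum_y \dim (common_ker N y))%N%:R.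
    by rewrite ler_wpM2l.
  move: Dv; rewrite /evdim -/e -natr1 mulrDr mulr1; lra.
by rewrite leqNgt cK.
Qed.

End CommonKernel.

(** * The induction step *)

Section Main.
Variables (R : realType) (F : fieldType) (Q : quiver) (beta : dimvec Q).
Implicit Types (V W : rep F Q).

Local Notation nchom V := (nchom R beta V).
Local Notation chi V := (chi V beta).

Lemma multiples_bound (m d d' hX b ha h : nat) (k e : R) :
  (hX <= m * ha + b)%N -> (ha <= d' * h)%N -> h%:R <= d%:R * (k + e) ->
  b%:R <= (m * (d * d'))%:R * e ->
  hX%:R <= (m * (d * d'))%:R * (k + e + e).
Proof.
move=> hXa /(leq_mul (leqnn m)) ha_le hk be.
have : (hX <= m * (d' * h) + b)%N by rewrite (leq_trans hXa) // leq_add2r.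
rewrite -(ler_nat R) natrD !natrM => hXh.
have : m%:R * (d'%:R * h%:R) <= m%:R * (d'%:R * (d%:R * (k + e))).
  by rewrite !ler_wpM2l.
by move: be; rewrite !natrM; lra.
Qed.

Lemma half_bound (c d hY h hX : nat) (a b : R) :
  (hY <= c * h + hX)%N -> h%:R <= d%:R * a -> hX%:R <= (c * d)%:R * b ->
  hY%:R <= (c * d)%:R * (a + b).
Proof.
rewrite -(ler_nat R) natrD !natrM => hYh ha.
have : c%:R * h%:R <= c%:R * (d%:R * a) by rewrite ler_wpM2l.
lra.
Qed.

Lemma euler_bound (d hV hS eV eS : nat) (cV cS : int) (a : R) :
  hV%:Z = eV%:Z + d%:Z * cV -> hS%:Z = eS%:Z + d%:Z * cS -> (eS <= eV)%N ->
  hV%:R <= d%:R * a -> hS%:R <= d%:R * (a - cV%:~R + cS%:~R).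
Proof.
move=> /(congr1 (fun z : int => z%:~R : R)) + /(congr1 (fun z : int => z%:~R : R)).
by rewrite !intrD !intrM /= -(ler_nat R); lra.
Qed.

(** As hV exceeds 2 N k by at most 3 N e, the minimum is at most 3 n N e; since s + 1 > N delta /
    n^2 >= 4 n N e, it equals p. Then 2 N k <= hV = hS + p + 2 N (cV - cS), and the bound on hS
    cancels one N k. *)
Lemma step_arithmetic (N n s p hV hS eV eS : nat) (cV cS : int)
    (k l e delta : R) :
  0 < N%:R :> R -> 0 < n%:R :> R -> 0 < e -> 4 * n%:R ^+ 3 * e <= delta ->
  N%:R * delta / (n * n)%:R < s.+1%:R ->
  (minn s.+1 p)%:R <= n%:R * (hV%:R - (N + N)%:R * k) ->
  (N + N)%:R * k <= hV%:R ->
  hV%:Z = eV%:Z + (N + N)%:Z * cV -> hS%:Z = eS%:Z + (N + N)%:Z * cS ->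
  eV = (eS + p)%N ->
  hV%:R <= N%:R * (k + e + (k + e + e)) ->
  hS%:R <= N%:R * (k + e - cV%:~R + cS%:~R + (l + e + e)) ->
  k <= cV%:~R - cS%:~R + l + (3 * n%:R + 3) * e.
Proof.
move=> N_gt0 n_gt0 e_gt0 de s2 rl kV.
move=> /(congr1 (fun z : int => z%:~R : R)) + /(congr1 (fun z : int => z%:~R : R)).
rewrite !intrD !intrM /= -!pmulrn !natrD => eVE eSE pE hVle hSle.
rewrite natrD in rl kV.
have {}rl : (minn s.+1 p)%:R <= n%:R * (N%:R * (3 * e)).
  by apply: le_trans rl _; rewrite ler_pM2l //; lra.
have s3 : n%:R * (N%:R * (3 * e)) < s.+1%:R.
  apply: le_lt_trans s2; rewrite natrM ler_pdivlMr ?mulr_gt0 //.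
  have := ler_wpM2l (ltW N_gt0) de.
  have : 0 <= N%:R * (n%:R ^+ 3 * e) by rewrite !mulr_ge0 ?exprn_ge0 ?ltW.
  rewrite exprS expr2; lra.
have pe : p%:R <= n%:R * (N%:R * (3 * e)).
  by move: rl; rewrite /minn; case: ifP => // _ /le_lt_trans/(_ s3); rewrite ltxx.
have {}pE : eV%:R = eS%:R + p%:R :> R by rewrite pE natrD.
rewrite -(ler_pM2l N_gt0); lra.
Qed.

(** Powers of W and W' share the dimension vector d d' beta. In their mixture with m layers, Hom
    from V is governed by W and Hom from S by W', up to constants that a large m absorbs. *)
Lemma simultaneous_approx V S d d' W W' (e : R) : 0 < e -> (0 < d * d')%N ->
  scaled_dim beta d W -> scaled_dim beta d' W' ->
  (\dim (Hom_Q V W))%:R <= d%:R * (nchom V + e) ->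
  (\dim (Hom_Q S W'))%:R <= d'%:R * (nchom S + e) ->
  exists m X, [/\ (0 < m)%N, scaled_dim beta (m * (d * d')) X,
    (\dim (Hom_Q V X))%:R <= (m * (d * d'))%:R * (nchom V + e + e)
  & (\dim (Hom_Q S X))%:R <= (m * (d * d'))%:R * (nchom S + e + e)].
Proof.
move=> e_gt0 dd_gt0 dW dW' hV hS.
have [Wa Wa_le] : exists Wa : Rep_of F (fun x => d * d' * beta x)%N, forall V,
    (\dim (Hom_Q V Wa) <= \dim (Hom_Q V (pow W d')))%N.
  by apply: standard_form => x; rewrite dim_pow dW mulnA [(d' * d)%N]mulnC.
have [Wb Wb_le] : exists Wb : Rep_of F (fun x => d * d' * beta x)%N, forall V,
    (\dim (Hom_Q V Wb) <= \dim (Hom_Q V (pow W' d)))%N.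
  by apply: standard_form => x; rewrite dim_pow dW' mulnA.
pose D : forall a, 'Hom(to_rep Wa (tl a), to_rep Wa (hd a)) := Wb.
pose J := (jump D V + dim (vertex_maps S Wa))%N.
have [m [m_gt0 Jm]] : exists m, (0 < m)%N /\ J%:R <= (m * (d * d'))%:R * e.
  exists (Num.truncn (J%:R / e)).+1; split=> //.
  have := ltW (truncnS_gt (J%:R / e)); rewrite ler_pdivrMr // => Jm.
  apply: le_trans Jm _; rewrite ler_pM2r // ler_nat.
  by rewrite -[X in (X <= _)%N]muln1 leq_mul2l dd_gt0 orbT.
have [X [dX HX]] := mix_ex D m.
exists m, X; split=> //.
- by move=> x; rewrite dX [dim _]mul1n mulnA.
- have [_ h1] := HX V.
  have h2 := leq_trans (leq_addr _ _) h1.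
  apply: (multiples_bound h2 (leq_trans (Wa_le V) (hom_pow W d' V)) hV).
  by rewrite (le_trans _ Jm) // ler_nat leq_addr.
- have [h1 _] := HX S; rewrite [(d * d')%N]mulnC.
  apply: (multiples_bound h1 (leq_trans (Wb_le S) (hom_pow W' d S)) hS).
  by rewrite [(d' * d)%N]mulnC (le_trans _ Jm) // ler_nat leq_addl.
Qed.

Lemma total_dim_sub_lt V (K : forall x, {vspace V x}) x (v : V x) :
  v \notin K x -> (\sum_y \dim (K y) < total_dim V)%N.
Proof.
move=> vK; rewrite /total_dim (bigD1 x) //= [X in (_ < X)%N](bigD1 x) //=.
have Ky y : (\dim (K y) <= dim (V y))%N by rewrite -dimvf dimvS ?subvf.
rewrite -addSn leq_add //; last by apply: leq_sum => y _; exact: Ky.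
rewrite ltn_neqAle Ky andbT; apply: contra vK => /eqP Kd.
have /eqP -> : K x == fullv by rewrite eqEdim subvf dimvf Kd /=.
exact: memvf.
Qed.

Lemma nchom_step V (e : R) : 0 < nchom V -> 0 < e ->
  4 * (total_dim V)%:R ^+ 3 * ((total_dim V)%:R + 1) * e <= nchom V ->
  exists K : forall x, {vspace V x},
    [/\ subrep K, (\sum_x \dim (K x) < total_dim V)%N
      & nchom V <= (chi V)%:~R - (chi (sub_rep K))%:~R + nchom (sub_rep K)
                   + (3 * (total_dim V)%:R + 3) * e].
Proof.
set k := nchom V => k_gt0 e_gt0 ek; set n := total_dim V in ek *.
have n1_gt0 : 0 < n%:R + 1 :> R by rewrite natr1 ltr0n.
have [d [W [d_gt0 dW hW]]] := nchom_approx beta V e_gt0.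
(* This excludes K = V, which would give d k <= dim Hom(V, W) <= d delta n < d k. *)
pose delta := k / (n%:R + 1).
have delta_gt0 : 0 < delta by rewrite divr_gt0.
have kE : k = delta * (n%:R + 1) by rewrite divfK // gt_eqF.
have dR_gt0 : 0 < d%:R :> R by rewrite ltr0n.
have [K [KS Kev Kd]] := robust_subrep V W (ltW (mulr_gt0 dR_gt0 delta_gt0)).
have Kn : (\sum_x \dim (K x) < n)%N.
  have [[x [v vK]]|noK] := pselect (exists x (v : V x), v \notin K x).
    exact: total_dim_sub_lt vK.
  have Kf x (v : V x) : v \in K x.
    by apply/negPn/negP => vK; apply: noK; exists x, v.
  have van0 : van W K = 0%VS.
    apply/eqP; rewrite -subv0; apply/subvP => f /vanP[_ f0].
    by rewrite memv0; apply/eqP/vmapP => x v; rewrite f0 // dpv0E zero_lfunE.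
  have := nchom_le R V dW; move: Kd; rewrite van0 dimv0 addr0 => h1 h2.
  have := le_trans h2 h1; rewrite -mulrA ler_pM2l // -/k kE ler_pM2l //.
  rewrite natr1 ler_nat => /leq_trans; move=> h3.
  suff : (\sum_x \dim (K x) <= n)%N by move/h3; rewrite ltnn.
  by apply: leq_sum => x _; rewrite -dimvf dimvS ?subvf.
exists K; split=> //; pose S := sub_rep K; rewrite -/S.
have n_gt0 : (0 < n)%N by exact: leq_ltn_trans Kn.
have nR_gt0 : 0 < n%:R :> R by rewrite ltr0n.
have [d' [W' [d'_gt0 dW' hW']]] := nchom_approx beta S e_gt0.
have dd_gt0 : (0 < d * d')%N by rewrite muln_gt0 d_gt0.
have [m [X [m_gt0 dX hVX hSX]]] :=
  simultaneous_approx e_gt0 dd_gt0 dW dW' hW hW'.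
(* The first half keeps [evdim] large outside K, the second is almost optimal for S; both are almost
   optimal for V. *)
pose Y := dsum (pow W (m * d')) X.
pose N := (m * (d * d'))%N.
have NE : (m * d' * d = N)%N by rewrite /N mulnAC mulnA.
have N_gt0 : 0 < N%:R :> R by rewrite ltr0n /N muln_gt0 m_gt0.
have dY : scaled_dim beta (N + N) Y.
  by rewrite -[in X in (X + _)%N]NE; apply: scaled_dim_dsum => //; exact: scaled_dim_pow.
have hVY : (\dim (Hom_Q V Y))%:R <= N%:R * ((k + e) + (k + e + e)).
  rewrite -/N -NE in hVX *; apply: half_bound hW hVX.
  exact: leq_trans (hom_dsum _ _ _) (leq_add (hom_pow _ _ _) (leqnn _)).
have hSW : (\dim (Hom_Q S W))%:R <=
    d%:R * (k + e - (chi V)%:~R + (chi S)%:~R).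
  apply: (euler_bound (hom_chi V dW) (hom_chi S dW)); last exact: hW.
  by rewrite (dim_Ext_sub W KS) leq_addr.
have hSY : (\dim (Hom_Q S Y))%:R <=
   N%:R * ((k + e - (chi V)%:~R + (chi S)%:~R) + (nchom S + e + e)).
  rewrite -/N -NE in hSX *; apply: half_bound hSW hSX.
  exact: leq_trans (hom_dsum _ _ _) (leq_add (hom_pow _ _ _) (leqnn _)).
have nn_gt0 : 0 < (n * n)%:R :> R by rewrite ltr0n muln_gt0 n_gt0.
(* The largest s with n^2 s <= N delta, the bound that [evdim] exceeds on the first half of Y. *)
pose s := Num.truncn (N%:R * delta / (n * n)%:R).
have /andP[s1 s2] : s%:R <= N%:R * delta / (n * n)%:R < s.+1%:R.
  by rewrite truncn_itv // divr_ge0 // mulr_ge0 // ltW.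
have KY x (v : V x) : v \notin K x -> (n * n * s < evdim Y K v)%N.
  move=> vK; apply: (@leq_trans (evdim (pow W (m * d')) K v)); last exact: evdim_dsum.
  apply: leq_trans (evdim_pow W K v (m * d')).
  have : N%:R * delta < (m * d' * evdim W K v)%:R.
    have := Kev x v vK; rewrite -(ltr_pM2l (x := (m * d')%:R)); last first.
      by rewrite ltr0n muln_gt0 m_gt0.
    by rewrite mulrA -!natrM NE.
  rewrite -(ltr_nat R); apply: le_lt_trans.
  by rewrite natrM mulrC -ler_pdivlMr.
have := rank_loss R n_gt0 dY KY.
have := dim_Ext_sub Y KS; set p := \dim _ => pE rl.
apply: (step_arithmetic N_gt0 nR_gt0 e_gt0 _ s2 rl (nchom_le R V dY) (hom_chi V dY)
   (hom_chi S dY) pE hVY hSY).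
by rewrite -(ler_pM2r n1_gt0) -kE mulrAC.
Qed.

End Main.

(** * Conclusion *)

Section Conclusion.
Variables (R : realType) (F : fieldType) (Q : quiver) (beta : dimvec Q).
Implicit Types (V W : rep F Q).

Local Notation nchom V := (nchom R beta V).
Local Notation chi V := (chi V beta).

Lemma subrep_trans V (K : forall x, {vspace V x})
    (U : forall x, {vspace sub_rep K x}) : subrep K -> subrep U ->
  exists2 U' : forall x, {vspace V x}, subrep U' & subdim U' = subdim U.
Proof.
move=> KS US; exists (fun x => (sub_inc K x @: U x)%VS).
  move=> a; apply/subvP => _ /memv_imgP[_ /memv_imgP[u uU ->] ->].
  rewrite -(sub_inc_morph KS) memv_img //.
  exact: (subvP (US a) _ (memv_img _ uU)).
apply/funext => x; rewrite /subdim limg_dim_eq //.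
have /eqP -> : lker (sub_inc K x) == 0%VS.
  by apply/lker0P; apply: can_inj (@sub_incK _ _ _ K x).
by rewrite capv0.
Qed.

Lemma int_lt_gap (k : R) : exists2 g : R, 0 < g
  & forall z : int, z%:~R < k -> z%:~R + g <= k.
Proof.
exists (k - (Num.ceil k - 1)%:~R); first by rewrite subr_gt0 ceilB1_lt.
move=> z; rewrite -ceil_gt_int => zk.
have : z <= Num.ceil k - 1 by rewrite lerBrDr lezD1.
rewrite -(ler_int R) => h.
by rewrite addrCA gerDl subr_le0.
Qed.

(** Induction on the total dimension: a U found inside K is also one of V, and chi(K) cancels. As K
    depends on e, integrality removes the error: if every U failed, each chi(V) - chi(U) would lie
    at least g below [nchom V]. *)
Lemma nchom_subrep V : exists2 U : forall x, {vspace V x},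
  subrep U & nchom V <= (chi V - euler (subdim U) beta)%:~R.
Proof.
have [m] := ubnP (total_dim V); elim: m V => // m IHm V Vm.
have [k0|k_gt0] := leP (nchom V) 0.
  exists (fun=> fullv) => [a|]; first exact: subvf.
  rewrite (_ : euler _ _ = chi V) ?subrr //.
  apply: (congr1 (fun b => euler b beta)); apply/funext => x.
  exact: dimvf.
apply: contrapT => noU.
have ltU (U : forall x, {vspace V x}) : subrep U ->
    (chi V - euler (subdim U) beta)%:~R < nchom V.
  by move=> US; rewrite ltNge; apply/negP => UV; apply: noU; exists U.
have [g g_gt0 gk] := int_lt_gap (nchom V).
pose n : R := (total_dim V)%:R.
have n_ge0 : 0 <= n by [].
(* The final 1 keeps [A] positive when n = 0; [B] makes the error (3 n + 3) e at most g / 2. *)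
pose A := 4 * n ^+ 3 * (n + 1) + 1.
pose B := 2 * (3 * n + 3).
have A_gt0 : 0 < A.
  have : 0 <= n ^+ 3 * (n + 1) by rewrite mulr_ge0 ?exprn_ge0 ?addr_ge0.
  by rewrite /A; lra.
have B_gt0 : 0 < B by rewrite /B; lra.
pose e := Num.min (nchom V / A) (g / B).
have e_gt0 : 0 < e by rewrite lt_min !divr_gt0.
have eA : A * e <= nchom V.
  by rewrite mulrC -ler_pdivlMr // ge_min lexx.
have eB : B * e <= g by rewrite mulrC -ler_pdivlMr // ge_min lexx orbT.
have [|K [KS Kn kV]] := @nchom_step R F Q beta V e k_gt0 e_gt0.
  by apply: le_trans eA; rewrite -/n /A ler_pM2r // lerDl.
have [|U US UK] := IHm (sub_rep K); first exact: leq_trans Kn _.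
have [U' US' dU'] := subrep_trans KS US.
have := gk _ (ltU _ US'); move: UK kV eB; rewrite dU' -/n /B !intrD !intrN; lra.
Qed.

(** Ext(V, W) maps onto Ext(U, W), and dim Hom(U, W) >= 0 in the Euler formula for U. *)
Lemma dim_Ext_ge V W d (U : forall x, {vspace V x}) : scaled_dim beta d W ->
  subrep U -> (- euler (subdim U) beta)%:~R * d%:R <= (dim_Ext V W)%:R :> R.
Proof.
move=> dW US; have := hom_chi (sub_rep U) dW.
have : (dim_Ext (sub_rep U) W <= dim_Ext V W)%N.
  by rewrite (dim_Ext_sub W US) leq_addr.
rewrite -(_ : chi (sub_rep U) = euler (subdim U) beta) //.
move=> h1 /(congr1 (fun z : int => z%:~R : R)).
rewrite intrD intrM /= -!pmulrn intrN => h2.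
have : 0 <= (\dim (Hom_Q (sub_rep U) W))%:R :> R by [].
by move: h1; rewrite -(ler_nat R); lra.
Qed.

Lemma min_hom_standard V d : exists2 W,
    scaled_dim beta d W /\ ext V (fun x => d * beta x)%N = dim_Ext V W
  & forall X, scaled_dim beta d X ->
      (\dim (Hom_Q V W) <= \dim (Hom_Q V X))%N.
Proof.
have [W Wmin] := min_hom_ex V (fun x => d * beta x)%N.
exists W; first by split; [move=> x; exact: mul1n | exact: ext_min_hom].
move=> X dX; have [X' X'le] := standard_form dX.
exact: leq_trans (Wmin X') (X'le V).
Qed.

Lemma ext_le V d X : scaled_dim beta d X ->
  (ext V (fun x => d * beta x)%N)%:R <=
  (\dim (Hom_Q V X))%:R - d%:R * (chi V)%:~R :> R.
Proof.
move=> dX; have [W [dW ->] Wle] := min_hom_standard V d.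
have := hom_chi V dW; have := Wle X dX; rewrite -(ler_nat R) => h1.
move=> /(congr1 (fun z : int => z%:~R : R)); rewrite intrD intrM /= -!pmulrn.
lra.
Qed.

Lemma ncext_seq_ge V (U : forall x, {vspace V x}) d : subrep U -> (0 < d)%N ->
  (- euler (subdim U) beta)%:~R <= ncext_seq R V beta d.
Proof.
move=> US d_gt0; rewrite /ncext_seq ler_pdivlMr ?ltr0n //.
have [W [dW ->] _] := min_hom_standard V d.
exact: dim_Ext_ge.
Qed.

(* Fekete's argument: direct sums make [d |-> ext V (d beta)] subadditive.   *)
Lemma ncext_seq_cvg V (U : forall x, {vspace V x}) : subrep U ->
  nchom V <= (chi V - euler (subdim U) beta)%:~R ->
  (ncext_seq R V beta @ \oo --> ((- euler (subdim U) beta)%:~R : R))%classic.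
Proof.
move=> US kU; apply/cvgrPdist_le => e e_gt0.
have e2_gt0 : 0 < e / 2 by rewrite divr_gt0.
have [d0 [W0 [d0_gt0 dW0 hW0]]] := nchom_approx beta V e2_gt0.
have [W1 dW1] := @scaled_dim_ex F Q beta 1.
(* Dividing d by d0 leaves fewer than d0 copies of [W1], which contribute at most [C] to dim Hom,
   hence at most d e / 2 for large d. *)
pose C : R := d0%:R * (\dim (Hom_Q V W1))%:R.
exists (Num.truncn (C / (e / 2))).+1 => // d /= Nd.
have d_gt0 : (0 < d)%N by exact: leq_ltn_trans Nd.
have dR_gt0 : 0 < d%:R :> R by rewrite ltr0n.
have Cd : C <= d%:R * (e / 2).
  rewrite -ler_pdivrMr //; apply: le_trans (ltW (truncnS_gt _)) _.
  by rewrite ler_nat.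
rewrite ler_norml; apply/andP; split; last first.
  by rewrite lerBlDr ler_wpDl ?ncext_seq_ge // ltW.
suff : ncext_seq R V beta d <= (- euler (subdim U) beta)%:~R + e by lra.
rewrite /ncext_seq ler_pdivrMr //.
pose X := dsum (pow W0 (d %/ d0)) (pow W1 (d %% d0)).
have dX : scaled_dim beta d X.
  have := scaled_dim_dsum (scaled_dim_pow (d %/ d0) dW0)
    (scaled_dim_pow (d %% d0) dW1).
  by rewrite muln1 -divn_eq.
apply: le_trans (ext_le V dX) _.
have hX := leq_trans (hom_dsum V _ _)
  (leq_add (hom_pow W0 (d %/ d0) V) (hom_pow W1 (d %% d0) V)).
have q : (d %/ d0)%:R * d0%:R <= d%:R :> R.
  by rewrite -natrM ler_nat leq_divM.
have r : (d %% d0)%:R <= d0%:R :> R by rewrite ler_nat ltnW // ltn_mod.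
have k_ge0 : 0 <= nchom V + e / 2 by rewrite addr_ge0 ?nchom_ge0 // ltW.
have h0 : (d %/ d0)%:R * (\dim (Hom_Q V W0))%:R <= d%:R * (nchom V + e / 2).
  apply: le_trans (ler_wpM2l _ hW0) _ => //.
  by rewrite mulrA ler_wpM2r.
have h1 : (d %% d0)%:R * (\dim (Hom_Q V W1))%:R <= C by rewrite ler_wpM2r.
have h2 := ler_wpM2l (ltW dR_gt0) kU.
move: hX h2; rewrite -(ler_nat R) natrD !natrM !intrD !intrN -/X; lra.
Qed.

End Conclusion.

Theorem theorem4p8 (R : realType) (F : fieldType) (Q : quiver)
    (beta : dimvec Q) (V : rep F Q) :
  cvgn (ncext_seq R V beta) /\
  is_max [set z : R | exists2 U : forall x, {vspace V x},
                        subrep U & z = (- euler (subdim U) beta)%:~R]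
         (ncext R V beta).
Proof.
have [U US kU] := nchom_subrep R beta V.
have UV := ncext_seq_cvg US kU.
have cvgV : cvgn (ncext_seq R V beta) by apply/cvg_ex; eexists; exact: UV.
split=> //; split=> [|_ [U' US' ->]]; first by exists U => //; exact: cvg_lim UV.
(* The bound starts at d = 1, as division by zero makes the term at d = 0 equal to 0. *)
by apply: limr_ge => //; exists 1%N => // d; exact: ncext_seq_ge.
Qed.
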